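(* Let $(X,\rho)$ be a complete separable metric space and let $\mathbf\Phi$ be an e-chain on $X$ with Feller's property and with transition function $P\colon X\times\mathcal B(X)\to[0,1]$. Assume that there exists $z\in X$ such that for every open set $O\subset X$ containing $z$ $$\liminf_{n\to\infty}P^n(x,O)>0\qquad\text{for all }x\in X .$$ Let $$\mathcal Z=\overline{\bigcup_{n=1}^\infty\operatorname{supp}P^n(z,\cdot)} .$$ If there exist a Lyapunov function $V\colon X\to[0,\infty)$ and $\lambda<1$, $b<\infty$, $R<\infty$, $x_0\in X$ such that $$PV(x)\le\lambda V(x)+b\,\mathbf 1_{B(x_0,R)}(x)\qquad\text{for all }x\in X,$$ then $\mathbf\Phi$ admits a unique invariant probability measure $\mu_*$ supported on $\mathcal Z$ (that is, there is exactly one invariant probability measure $\mu_*$ with $\operatorname{supp}\mu_*\subset\mathcal Z$). Moreover, $\mu P^n$ converges weakly to $\mu_*$ as $n\to\infty$ for every Borel probability measure $\mu$ on $X$ with $\operatorname{supp}\mu\subset\mathcal Z$.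
   Context: $\mathcal B(X)$ is the Borel $\sigma$-algebra of $X$, $\mathbb N=\{1,2,\dots\}$, and $B(x,r)$ is the ball of center $x$ and radius $r$. A transition function $P$ is a Markov kernel: $P(x,\cdot)$ is a Borel probability measure for each $x\in X$ and $x\mapsto P(x,A)$ is Borel measurable for each $A\in\mathcal B(X)$. $P^n$ denotes the $n$-step transition function ($P^1=P$, $P^{n+1}(x,A)=\int_X P^n(y,A)\,P(x,dy)$), $P^nf(x)=\int_X f(y)\,P^n(x,dy)$ (likewise $PV(x)=\int_X V(y)\,P(x,dy)$), and $\mu P^n(A)=\int_X P^n(x,A)\,\mu(dx)$ for a Borel measure $\mu$. Feller's property: $x\mapsto P(x,U)$ is lower semicontinuous for every open $U\subset X$; equivalently, $Pf$ is bounded and continuous for every bounded continuous $f\colon X\to\mathbb R$. A Borel measure $\mu$ is invariant for $\mathbf\Phi$ if $\mu P=\mu$. The support of a Borel measure $\mu$ is $\operatorname{supp}\mu=\{x\in X\colon\mu(B(x,\varepsilon))>0\text{ for every }\varepsilon>0\}$. Weak convergence means convergence of integrals of all bounded continuous functions. $C_b(X)$ denotes the space of bounded continuous real functions on $X$ with bounded support. $\mathbf\Phi$ is an e-chain if for every $f\in C_b(X)$ the family $\{P^nf\colon n\in\mathbb N\}$ is equicontinuous on compact subsets of $X$; equivalently, it is equicontinuous at every point $x\in X$ (for every $\varepsilon>0$ there is $\delta>0$ with $|P^nf(y)-P^nf(x)|<\varepsilon$ for all $n\in\mathbb N$ and all $y$ with $\rho(x,y)<\delta$). A Lyapunov function is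 a continuous $V\colon X\to[0,\infty)$ such that $V(x)\to\infty$ as $\rho(x,x')\to\infty$ for some $x'\in X$. *)

(* Defs.v *)
From HB Require Import structures.
From mathcomp Require Import all_boot all_order all_algebra.
From mathcomp Require Import all_classical all_reals all_analysis.
Set Implicit Arguments.
Unset Strict Implicit.
Unset Printing Implicit Defensive.
Import Order.TTheory GRing.Theory Num.Theory.
Import numFieldNormedType.Exports.
Local Open Scope classical_set_scope.
Local Open Scope ring_scope.
Local Open Scope ereal_scope.

(* The point carried by [Complete] is the one that [measurableType] requires of
   every measurable space; it only asserts that the space is nonempty. *)
#[short(type="completeMetricType")]
HB.structure Definition CompleteMetric (K : numDomainType) :=
  { T of Metric K T & Complete T }.

Definition separable (T : topologicalType) :=
  exists2 D : set T, countable D & dense D.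

Definition borel (R : realType) (X : completeMetricType R) :=
  g_sigma_algebraType (@open X).

HB.instance Definition _ (R : realType) (X : completeMetricType R) :=
  Measurable.on (borel X).
HB.instance Definition _ (R : realType) (X : completeMetricType R) :=
  CompleteMetric.on (borel X).

Section n_step.
Context d (T : measurableType d) (R : realType).

(* [kcomp_noparam P Q x A] is the integral of [Q y A] against [P x] in [y]. *)
Fixpoint nstep (P : R.-spker T ~> T) (n : nat) : R.-spker T ~> T :=
  match n with
  | 0%N => kdirac (@measurable_id _ T setT)
  | m.+1 => match m with
            | 0%N => P
            | _.+1 => mkcomp_noparam P (nstep P m)
            end
  end.

End n_step.

Section measure_kernel.
Context d (T : measurableType d) (R : realType).
Variables (mu : {measure set T -> \bar R}) (k : R.-ker T ~> T).

Definition mapply (A : set T) : \bar R := \int[mu]_x k x A.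

Let mapply0 : mapply set0 = 0.
Proof. by apply: integral0_eq => x _; rewrite measure0. Qed.

Let mapply_ge0 A : 0 <= mapply A.
Proof. exact: integral_ge0. Qed.

Let mapply_sigma_additive : semi_sigma_additive mapply.
Proof.
move=> F mF tF mUF; rewrite [X in _ --> X](_ : _ =
    \int[mu]_x (\sum_(n <oo) k x (F n))); last first.
  apply: eq_integral => x _.
  by apply/esym/cvg_lim => //; exact/measure_semi_sigma_additive.
apply/cvg_closeP; split.
  by apply: is_cvg_nneseries => n _ _; exact: integral_ge0.
by rewrite closeE// integral_nneseries// => n; exact: measurable_kernel.
Qed.

HB.instance Definition _ := isMeasure.Build _ T R mapply
  mapply0 mapply_ge0 mapply_sigma_additive.

(* Measures are functions on all sets but only their values on measurable sets
   are meaningful, hence the restriction on [A]. *)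
Definition invariant_measure :=
  forall A, measurable A -> mapply A = mu A.

End measure_kernel.

Section borel_measures.
Context (R : realType) (X : completeMetricType R).

Definition msupport (mu : {measure set (borel X) -> \bar R}) : set X :=
  [set x | forall e : R, (0 < e)%R -> 0 < mu (ball x e)].

Definition cvg_weak (mu_ : nat -> {measure set (borel X) -> \bar R})
    (mu : {measure set (borel X) -> \bar R}) :=
  forall f : X -> R, continuous f -> bounded_fun f ->
    (fun n => \int[mu_ n]_x f x)%R @ \oo --> (\int[mu]_x f x)%R.

Definition feller (P : R.-pker (borel X) ~> (borel X)) :=
  forall U : set X, open U -> lower_semicontinuous (fun x : X => P x U).

Definition in_ball (A : set X) := exists (c : X) (r : R), A `<=` ball c r.

Definition Cb : set (X -> R) :=
  [set f | [/\ continuous f, bounded_fun f &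
    in_ball (closure [set x | f x != 0%R])]].

(* Equicontinuity on a compact set [K] is that of the restrictions to [K], so
   the library's pointwise notion is used on [subspace K]. *)
Definition e_chain (P : R.-pker (borel X) ~> (borel X)) :=
  forall f, Cb f -> forall K : set X, compact K ->
    @equicontinuous (subspace K) R nat [set n | (0 < n)%N]
      (fun n x => \int[nstep P n x]_y f y)%R.

Definition lyapunov (V : X -> R) :=
  [/\ continuous V, (forall x, 0 <= V x)%R &
    exists x' : X, forall A : R, exists B : R,
      forall x, (B < mdist x x')%R -> (A < V x)%R].

End borel_measures.

(* Main.v *)
(* The Lyapunov function makes the laws of the chain uniformly concentrated on
   bounded sets, so that the iterates of every bounded continuous function, and not
   only of those with bounded support, are equicontinuous.  A gliding hump argument
   and the recurrence at [z] then give tightness of the laws [P^n(z, .)] in the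
   following form: if [w] is continuous and positive, then [P^n(z, {w < c})] tends to
   [0] with [c] uniformly in [n].  By Dini's argument, the recurrence is therefore
   uniform up to a small mass, which allows one to couple two copies of the chain
   started from pieces of the laws [P^n(z, .)]: again and again equal fractions of both
   are near [z] at the same time, and from then on they stay close by equicontinuity.
   Hence [P^n f(x)] converges to a limit [Lam f], the same for all [x] in [Z], and
   tightness shows that [Lam] is a Daniell integral; its measure is the invariant
   one. *)
Require Import Defs.
From HB Require Import structures.
From mathcomp Require Import all_boot all_order all_algebra.
From mathcomp Require Import all_classical all_reals all_analysis.
From mathcomp Require Import measurable_realfun ring lra.
Set Implicit Arguments.
Unset Strict Implicit.
Unset Printing Implicit Defensive.
Import Order.TTheory GRing.Theory Num.Theory.
Import numFieldNormedType.Exports.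
Local Open Scope classical_set_scope.
Local Open Scope ring_scope.
Local Open Scope ereal_scope.

(** * Markov operators on bounded functions *)

(** The space need not be locally compact, so tightness is not sought on compact sets: sublevel sets
    [{w <= c}] of positive continuous functions, with [c] small, are shown to be avoided instead.
    The [w] that matters to the coupling comes from the recurrence, whose waiting time and lower
    bound both depend on the starting point: it is a weighted supremum of the infima over large
    times of [P^n (tent z r)], continuous by equicontinuity and positive by recurrence. Outside
    [{w <= c}] one time and one bound serve all points. Every round of the coupling uses tightness
    again, hence its pieces must stay below laws started at [z]. They are handled as functionals on
    bounded measurable functions, so that no measure has to be built for a remainder. A point of the
    support of [P^m(z, .)] enters through the part of this law lying in a small ball around it,
    which is compared with the same multiple of the Dirac mass at [z]; this carries convergence from
    [z] to all of [Z]. *)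

Section bounded_measurable.
Context d {T : measurableType d} {R : realType}.
Local Open Scope ring_scope.
Implicit Types f g : T -> R.

Definition bounded_by (U : Type) (f : U -> R) := exists M, forall x, `|f x| <= M.

Definition bmeas f := measurable_fun setT f /\ bounded_by f.

Lemma bmeas_cst (c : R) : bmeas (fun=> c).
Proof. by split; [exact: measurable_cst|exists `|c|]. Qed.

Lemma bmeasD f g : bmeas f -> bmeas g -> bmeas (fun x => f x + g x).
Proof.
move=> [mf [M fM]] [mg [N gN]]; split; first exact: measurable_funD.
by exists (M + N) => x; rewrite (le_trans (ler_normD _ _))// lerD.
Qed.

Lemma bmeasM f g : bmeas f -> bmeas g -> bmeas (fun x => f x * g x).
Proof.
move=> [mf [M fM]] [mg [N gN]]; split; first exact: measurable_funM.
by exists (M * N) => x; rewrite normrM ler_pM.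
Qed.

Lemma bmeasZ c f : bmeas f -> bmeas (fun x => c * f x).
Proof. by move=> bf; apply: bmeasM => //; exact: bmeas_cst. Qed.

Lemma bmeasB f g : bmeas f -> bmeas g -> bmeas (fun x => f x - g x).
Proof.
move=> bf bg; under eq_fun do rewrite -mulN1r.
by apply: bmeasD => //; exact: bmeasZ.
Qed.

Lemma bmeas_indic (A : set T) : measurable A -> bmeas (\1_A : T -> R).
Proof.
move=> mA; split; first exact: measurable_indic.
by exists 1 => x; rewrite indicE; case: (_ \in _); rewrite ?normr1 ?normr0.
Qed.

Section integral.
Variable m : {measure set T -> \bar R}.
Hypothesis m1 : m setT = 1%E.
Local Notation I f := (\int[m]_x f x).

Lemma bmeas_integrable f : bmeas f -> m.-integrable setT (EFin \o f).
Proof.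
move=> [mf [M fM]]; apply: measurable_bounded_integrable => //.
  by rewrite m1 ltry.
exists M; split; first exact: num_real.
by move=> N MN x _ /=; rewrite (le_trans (fM x))// ltW.
Qed.

Lemma integralE_bmeas f : bmeas f -> (\int[m]_x (f x)%:E)%E = (I f)%:E.
Proof. by move=> bf; rewrite fineK//; exact/integrable_fin_num/bmeas_integrable. Qed.

Lemma bintegralD f g : bmeas f -> bmeas g -> I (fun x => f x + g x) = I f + I g.
Proof. by move=> bf bg; rewrite RintegralD//; exact: bmeas_integrable. Qed.

Lemma bintegralB f g : bmeas f -> bmeas g -> I (fun x => f x - g x) = I f - I g.
Proof. by move=> bf bg; rewrite RintegralB//; exact: bmeas_integrable. Qed.

Lemma bintegralZ c f : bmeas f -> I (fun x => c * f x) = c * I f.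
Proof. by move=> bf; rewrite RintegralZl//; exact: bmeas_integrable. Qed.

Lemma bintegral_le f g : bmeas f -> bmeas g -> (forall x, f x <= g x) -> I f <= I g.
Proof. by move=> bf bg fg; rewrite le_Rintegral//; exact: bmeas_integrable. Qed.

Lemma bintegral_cst c : I (fun=> c) = c.
Proof. by rewrite Rintegral_cst// [X in fine X]m1 mulr1. Qed.

Lemma bintegral_le_cst f c : bmeas f -> (forall x, f x <= c) -> I f <= c.
Proof.
by move=> bf fc; rewrite -[leRHS]bintegral_cst; apply: bintegral_le => //; exact: bmeas_cst.
Qed.

Lemma bintegral_ge_cst f c : bmeas f -> (forall x, c <= f x) -> c <= I f.
Proof.
by move=> bf fc; rewrite -[leLHS]bintegral_cst; apply: bintegral_le => //; exact: bmeas_cst.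
Qed.

Lemma bintegral_norm_le f c : bmeas f -> (forall x, `|f x| <= c) -> `|I f| <= c.
Proof.
move=> bf fc; rewrite ler_norml; apply/andP; split.
  by apply: bintegral_ge_cst => // x; move: (fc x); rewrite ler_norml => /andP[].
by apply: bintegral_le_cst => // x; move: (fc x); rewrite ler_norml => /andP[].
Qed.

Lemma bintegral_indic (A : set T) : measurable A -> (I \1_A)%:E = m A.
Proof.
move=> mA; rewrite -integralE_bmeas; last exact: bmeas_indic.
by rewrite integral_indic// setIT.
Qed.

Lemma bintegral_cvg (f_ : nat -> T -> R) f (M : R) : (forall n, bmeas (f_ n)) ->
  bmeas f -> (forall n x, `|f_ n x| <= M) ->
  {ae m, forall x, f_ n x @[n --> \oo] --> f x} ->
  I (f_ n) @[n --> \oo] --> I f.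
Proof.
move=> bf_ bf fM ff.
have [] := @dominated_convergence _ _ _ m setT measurableT (fun n x => (f_ n x)%:E)
  (EFin \o f) (EFin \o (fun=> M)).
- by move=> n; apply/measurable_EFinP; case: (bf_ n).
- by apply/measurable_EFinP; case: bf.
- by apply: filterS ff => x ffx _; apply: cvg_EFin ffx; exact: nearW.
- exact: bmeas_integrable (bmeas_cst _).
- by apply: aeW => x n _; rewrite /= lee_fin.
move=> _ _; rewrite integralE_bmeas// => /fine_cvg; exact.
Qed.

End integral.

End bounded_measurable.

Section compositions.
Context d (T : measurableType d) (R : realType).

Lemma ge0_integral_mapply_kernel (l k : R.-spker T ~> T) (x : T) (f : T -> \bar R) :
  (forall y, 0 <= f y) -> measurable_fun setT f ->
  \int[mapply (l x) k]_y f y = \int[l x]_y \int[k y]_w f w.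
Proof.
(* [mapply (l x) k] is convertible to the composition of [l] with [k] read as a kernel on pairs that
   ignores the first coordinate. *)
by move=> f0 mf; rewrite -(integral_kcomp l (kernel.kernel_snd (T0 := T) k)).
Qed.

Lemma ge0_integral_mapply (mu : probability T R) (k : R.-spker T ~> T) (f : T -> \bar R) :
  (forall y, 0 <= f y) -> measurable_fun setT f ->
  \int[mapply mu k]_y f y = \int[mu]_y \int[k y]_w f w.
Proof.
move=> f0 mf.
(* A probability is a kernel constant in its parameter, here evaluated at the arbitrary [point]. *)
have mmu : measurable_fun [set: T] (fun _ : T => mu : pprobability T R) by exact: measurable_cst.
exact: (ge0_integral_mapply_kernel (kprobability mmu) k point).
Qed.

End compositions.

Section kernel_integral.
Context d (T : measurableType d) (R : realType).
Local Open Scope ring_scope.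
Variable k : R.-spker T ~> T.
Hypothesis k1 : forall x, k x setT = 1%E.
Implicit Type f : T -> R.

(** Composition of kernels is expressed by integrals of non-negative extended functions; adding a
    constant carries the formulas over to bounded real functions, since all masses are one. *)
Lemma bmeas_shift f : bmeas f ->
  exists2 M, bmeas (fun x => f x + M) & forall x, 0 <= f x + M.
Proof.
move=> bf; have [_ [M fM]] := bf; exists M; first by apply: bmeasD => //; exact: bmeas_cst.
by move=> x; have := fM x; rewrite ler_norml => /andP[]; rewrite -subr_ge0 opprK.
Qed.

Lemma bmeas_kernel_integral f : bmeas f -> bmeas (fun x => \int[k x]_y f y).
Proof.
move=> bf; split; last first.
  have [_ [M fM]] := bf; exists M => x.
  exact: bintegral_norm_le.
have [M bfM fM0] := bmeas_shift bf.
rewrite (_ : (fun x => _) = (fun x => fine (\int[k x]_y (f y + M)%:E)%E - M)).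
  apply: measurable_funB => //; apply: measurableT_comp => //.
  apply: measurable_fun_integral_kernel => //.
  - by move=> U mU; exact: measurable_kernel.
  - by apply/measurable_EFinP; case: bfM.
apply/funext => x.
have := bintegralD (k1 x) bf (bmeas_cst M).
by rewrite bintegral_cst// /Rintegral => ->; rewrite addrK.
Qed.

Lemma bintegral_disintegration (mu m : {measure set T -> \bar R}) f :
  mu setT = 1%E -> m setT = 1%E ->
  (forall g : T -> \bar R, (forall x, 0 <= g x)%E -> measurable_fun setT g ->
    (\int[m]_x g x = \int[mu]_x \int[k x]_y g y)%E) ->
  bmeas f -> \int[m]_x f x = \int[mu]_x (\int[k x]_y f y).
Proof.
move=> mu1 m1 mE bf; have [M bfM fM0] := bmeas_shift bf.
have addM (nu : {measure set T -> \bar R}) g : nu setT = 1%E -> bmeas g ->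
    \int[nu]_x g x + M = \int[nu]_x (g x + M).
  by move=> nu1 bg; rewrite (bintegralD nu1 bg (bmeas_cst M)) bintegral_cst.
apply: (@addIr _ M); rewrite !addM//; last exact: bmeas_kernel_integral.
transitivity (\int[mu]_x (\int[k x]_y (f y + M))); last first.
  apply: eq_Rintegral => x _; rewrite addM//.
rewrite {1}/Rintegral mE; first by congr fine; apply: eq_integral => x _; rewrite integralE_bmeas.
  by move=> x; exact: fM0.
by apply/measurable_EFinP; case: bfM.
Qed.

End kernel_integral.

Section n_step_operator.
Context d (T : measurableType d) (R : realType) (P : R.-pker T ~> T).
Local Open Scope ring_scope.
Implicit Type f : T -> R.

Definition nexp n f (x : T) : R := \int[nstep P n x]_y f y.

Lemma nstepSE n x A : measurable A -> nstep P n.+1 x A = mapply (P x) (nstep P n) A.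
Proof.
(* [nstep] is [P] itself at time 1, so the recursion has to be checked there against the Dirac
   kernel of time 0. *)
case: n => [|n] mA //=; rewrite /mapply /= /kdirac.
transitivity (\int[P x]_y (\1_A y)%:E)%E; first by rewrite integral_indic// setIT.
by apply: eq_integral => y _; rewrite diracE indicE.
Qed.

Lemma nstep_setT n x : nstep P n x setT = 1%E.
Proof.
elim: n x => [x|n ih x]; first by rewrite /= /kdirac/= diracT.
rewrite nstepSE//= /mapply; under eq_integral do rewrite ih.
by rewrite integral_cst// mul1e prob_kernel.
Qed.

Lemma ge0_integral_nstepS n x (g : T -> \bar R) :
  (forall x, 0 <= g x)%E -> measurable_fun setT g ->
  (\int[nstep P n.+1 x]_y g y = \int[P x]_y \int[nstep P n y]_w g w)%E.
Proof.
move=> g0 mg; rewrite -ge0_integral_mapply_kernel//.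
by apply: eq_measure_integral => A mA _; exact: nstepSE.
Qed.

Lemma bmeas_nexp n f : bmeas f -> bmeas (nexp n f).
Proof. by apply: bmeas_kernel_integral; exact: nstep_setT. Qed.

Lemma nexp0 f : bmeas f -> nexp 0 f = f.
Proof.
move=> [mf _]; apply/funext => x; rewrite /nexp /Rintegral /= /kdirac.
rewrite integral_dirac//; last exact/measurable_EFinP.
by rewrite diracT mul1e.
Qed.

Lemma nexp1E f x : nexp 1 f x = \int[P x]_y f y. Proof. by []. Qed.

Lemma nexpS n f : bmeas f -> nexp n.+1 f = nexp 1 (nexp n f).
Proof.
move=> bf; apply/funext => x; rewrite nexp1E; apply: bintegral_disintegration => //.
- exact: nstep_setT.
- by rewrite prob_kernel.
- exact: nstep_setT.
- exact: ge0_integral_nstepS.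
Qed.

Lemma nexpD n m f : bmeas f -> nexp (n + m) f = nexp n (nexp m f).
Proof.
move=> bf; elim: n => [|n ih]; first by rewrite nexp0//; exact: bmeas_nexp.
by rewrite addSn nexpS// ih -nexpS//; exact: bmeas_nexp.
Qed.

Section linearity.
Variable n : nat.
Implicit Type g : T -> R.

Lemma nexpDl f g x : bmeas f -> bmeas g -> nexp n (fun y => f y + g y) x = nexp n f x + nexp n g x.
Proof. exact/bintegralD/nstep_setT. Qed.

Lemma nexpB f g x : bmeas f -> bmeas g -> nexp n (fun y => f y - g y) x = nexp n f x - nexp n g x.
Proof. exact/bintegralB/nstep_setT. Qed.

Lemma nexpZ c f x : bmeas f -> nexp n (fun y => c * f y) x = c * nexp n f x.
Proof. exact/bintegralZ/nstep_setT. Qed.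

Lemma nexp_le f g x : bmeas f -> bmeas g -> (forall y, f y <= g y) -> nexp n f x <= nexp n g x.
Proof. exact/bintegral_le/nstep_setT. Qed.

Lemma nexp_cst c x : nexp n (fun=> c) x = c.
Proof. exact/bintegral_cst/nstep_setT. Qed.

Lemma nexp_le_cst f c x : bmeas f -> (forall y, f y <= c) -> nexp n f x <= c.
Proof. exact/bintegral_le_cst/nstep_setT. Qed.

Lemma nexp_ge_cst f c x : bmeas f -> (forall y, c <= f y) -> c <= nexp n f x.
Proof. exact/bintegral_ge_cst/nstep_setT. Qed.

Lemma nexp_norm_le f c x : bmeas f -> (forall y, `|f y| <= c) -> `|nexp n f x| <= c.
Proof. exact/bintegral_norm_le/nstep_setT. Qed.

Lemma nexp_indic A x : measurable A -> (nexp n \1_A x)%:E = nstep P n x A.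
Proof. exact/bintegral_indic/nstep_setT. Qed.

End linearity.

Lemma bintegral_mapply (mu : probability T R) n f : bmeas f ->
  \int[mapply mu (nstep P n)]_x f x = \int[mu]_x nexp n f x.
Proof.
move=> bf; apply: bintegral_disintegration => //.
- exact: nstep_setT.
- exact: probability_setT.
- rewrite /= /mapply; under eq_integral do rewrite nstep_setT.
  by rewrite integral_cst// mul1e; exact: probability_setT.
- exact: ge0_integral_mapply.
Qed.

End n_step_operator.

(** * Bounded continuous functions *)

Section bounded_continuous.
Context {R : realType} {X : completeMetricType R}.
Local Open Scope ring_scope.
Implicit Types f g : X -> R.

Lemma continuous_epsP f : continuous f <->
  forall x e, 0 < e -> exists2 d, 0 < d & forall y, ball x d y -> `|f y - f x| <= e.
Proof.
split=> [cf x e e0|cf x].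
  have /cvgrPdist_le/(_ _ e0)/nbhs_ballP[d /= d0 df] := cf x.
  by exists d => // y /df; rewrite distrC.
apply/cvgrPdist_le => e e0; apply/nbhs_ballP; have [d d0 df] := cf x _ e0.
by exists d => // y /df; rewrite distrC.
Qed.

Lemma continuous_ball f x e : continuous f -> 0 < e ->
  exists2 d, 0 < d & forall y, ball x d y -> `|f y - f x| <= e.
Proof. by move=> /continuous_epsP; exact. Qed.

Definition bcont f := continuous f /\ bounded_by f.

Lemma continuous_measurable_borel f : continuous f -> measurable_fun setT (f : borel X -> R).
Proof.
move=> /continuousP cf; apply: (measurability _ (RGenOpens.measurableE R)).
move=> _ [_ [a [b ->] <-]]; rewrite setTI; apply: sub_sigma_algebra.
exact/cf/interval_open.
Qed.

Lemma open_measurable_borel (U : set X) : open U -> measurable (U : set (borel X)).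
Proof. exact: sub_sigma_algebra. Qed.

Lemma bcont_bmeas f : bcont f -> bmeas (f : borel X -> R).
Proof. by move=> [cf bf]; split => //; exact: continuous_measurable_borel. Qed.

Lemma bcont_cst c : bcont (fun=> c).
Proof. by split; [exact: cst_continuous|exists `|c|]. Qed.

Lemma bcontD f g : bcont f -> bcont g -> bcont (fun x => f x + g x).
Proof.
move=> [cf [M fM]] [cg [N gN]]; split; first by move=> x; apply: continuousD; [exact: cf|exact: cg].
by exists (M + N) => x; rewrite (le_trans (ler_normD _ _))// lerD.
Qed.

Lemma bcontM f g : bcont f -> bcont g -> bcont (fun x => f x * g x).
Proof.
move=> [cf [M fM]] [cg [N gN]]; split; first by move=> x; apply: continuousM; [exact: cf|exact: cg].
by exists (M * N) => x; rewrite normrM ler_pM.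
Qed.

Lemma bcontZ c f : bcont f -> bcont (fun x => c * f x).
Proof. by move=> bf; apply: bcontM => //; exact: bcont_cst. Qed.

Lemma bcontB f g : bcont f -> bcont g -> bcont (fun x => f x - g x).
Proof.
move=> bf bg; under eq_fun do rewrite -mulN1r.
by apply: bcontD => //; exact: bcontZ.
Qed.

Lemma continuous_maxr f g : continuous f -> continuous g ->
  continuous (fun x => Num.max (f x) (g x)).
Proof. by move=> cf cg x; exact: (continuous_max (cf x) (cg x)). Qed.

Lemma continuous_minr f g : continuous f -> continuous g ->
  continuous (fun x => Num.min (f x) (g x)).
Proof. by move=> cf cg x; exact: (continuous_min (cf x) (cg x)). Qed.

Lemma continuous_mdist (x : X) : continuous (fun y => mdist x y).
Proof.
apply/continuous_epsP => y e e0; exists e => // w; rewrite ballEmdist/= => yw.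
rewrite ler_distl; apply/andP; split.
  by rewrite lerBlDr (le_trans (metric_triangle x w y))// lerD2l metric_sym ltW.
by rewrite (le_trans (metric_triangle x y w))// lerD2l ltW.
Qed.

Definition clamp (t : R) : R := Num.max 0 (Num.min 1 t).

Lemma clamp_ge0 t : 0 <= clamp t. Proof. by rewrite le_max lexx. Qed.

Lemma clamp_le1 t : clamp t <= 1.
Proof. by rewrite ge_max ler01 ge_min lexx. Qed.

Lemma clamp_id t : 0 <= t -> t <= 1 -> clamp t = t.
Proof. by move=> t0 t1; rewrite /clamp min_r// max_r. Qed.

Lemma clamp_eq0 t : t <= 0 -> clamp t = 0.
Proof. by move=> t0; rewrite /clamp min_r ?max_l// (le_trans t0). Qed.

Lemma clamp_eq1 t : 1 <= t -> clamp t = 1.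
Proof. by move=> t1; rewrite /clamp min_l// max_r. Qed.

Lemma bcont_clamp f : continuous f -> bcont (fun x => clamp (f x)).
Proof.
move=> cf; split.
  apply: continuous_maxr; first exact: cst_continuous.
  by apply: continuous_minr => //; exact: cst_continuous.
by exists 1 => x; rewrite ger0_norm ?clamp_ge0// clamp_le1.
Qed.

Definition tent (x : X) r (y : X) : R := clamp (2 - 2 * mdist x y / r).

Lemma tent_ge0 x r y : 0 <= tent x r y. Proof. exact: clamp_ge0. Qed.

Lemma tent_le1 x r y : tent x r y <= 1. Proof. exact: clamp_le1. Qed.

Lemma tent_eq1 x r y : 0 < r -> ball x (r / 2) y -> tent x r y = 1.
Proof.
move=> r0; rewrite ballEmdist/= => xy; apply: clamp_eq1.
rewrite lerBrDr -lerBrDl ler_pdivrMr//; rewrite ltr_pdivlMr// in xy; lra.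
Qed.

Lemma tent_eq0 x r y : 0 < r -> ~ ball x r y -> tent x r y = 0.
Proof.
move=> r0; rewrite ballEmdist/= => /negP; rewrite -leNgt => xy; apply: clamp_eq0.
by rewrite subr_le0 ler_pdivlMr//; lra.
Qed.

Lemma bcont_tent x r : bcont (tent x r).
Proof.
apply: bcont_clamp => y; apply: cvgB; first exact: cvg_cst.
by apply: cvgMr_tmp; apply: cvgMl_tmp; exact: continuous_mdist.
Qed.

End bounded_continuous.

Section compact_sequence.
Context {T : topologicalType}.

(** A filter on this set either clusters at [l] or contains a set missing a neighbourhood of [l]; in
    the latter case it lives on finitely many terms of the sequence. *)
Lemma compact_cvg_seq (u : nat -> T) (l : T) : u n @[n --> \oo] --> l ->
  compact (l |` range u).
Proof.
move=> ul F PF FK; apply: contrapT => nclu.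
have : ~ cluster F l by move=> cFl; apply: nclu; exists l; split => //; left.
move=> /existsNP[A /existsNP[B /not_implyP[FA /not_implyP[lB AB]]]].
have [N _ uB] := ul _ lB.
have finK : compact (u @` `I_N).
  by apply: finite_compact; exact: finite_image.
have FN : F (u @` `I_N).
  apply: filterS (filterI FA FK) => x [Ax [xl|[n _ unx]]].
    by exfalso; apply: AB; exists x; split => //; rewrite xl; exact: nbhs_singleton.
  exists n => //; rewrite /= ltnNge; apply/negP => Nn; apply: AB; exists x; split => //.
  by rewrite -unx; exact: uB.
have [x [[n _ unx] clx]] := finK F PF FN.
by apply: nclu; exists x; split => //; right; exists n.
Qed.

End compact_sequence.

(** * Equicontinuity without the bounded support condition *)

Section lyapunov_bound.
Context {R : realType} {X : completeMetricType R}.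
Variable P : R.-pker (borel X) ~> (borel X).
Variables (V : X -> R) (lambda b r : R) (x0 : X).
Hypothesis lyapV : lyapunov V.
Hypothesis lambda1 : (lambda < 1)%R.
Hypothesis PV : forall x : X, \int[P x]_y (V y)%:E <=
  (lambda * V x + b * \1_(ball x0 r) x)%:E.

Lemma lyapunov_nstep : exists c : R, forall n (x : X),
  \int[nstep P n x]_y (V y)%:E <= (V x + c)%:E.
Proof.
have [cV V0 _] := lyapV.
have mV : measurable_fun [set: borel X] (EFin \o V).
  by apply/measurable_EFinP; exact: continuous_measurable_borel.
have EV0 (y : borel X) : 0 <= (V y)%:E by rewrite lee_fin.
(* [lambda] and [b] may be negative, hence the truncations. [c] is the fixed point of
   [t |-> l * t + Num.max b 0], so that the bound [l ^+ n * V x + c * (1 - l ^+ n)] reproduces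
   itself under [P]. *)
pose l := Num.max lambda 0%R; pose c := (Num.max b 0 / (1 - l))%R.
have l0 : (0 <= l)%R by rewrite le_max lexx orbT.
have l1 : (0 < 1 - l)%R by rewrite subr_gt0 gt_max lambda1 ltr01.
have c0 : (0 <= c)%R by rewrite divr_ge0 ?(ltW l1)// le_max lexx orbT.
have PVl (x : borel X) : \int[P x]_y (V y)%:E <= (l * V x + c * (1 - l))%:E.
  apply: (le_trans (PV x)); rewrite lee_fin divfK ?gt_eqF// lerD//.
    by rewrite ler_wpM2r// le_max lexx.
  rewrite indicE; case: (_ \in _); rewrite ?mulr1 ?mulr0 le_max lexx//.
  by rewrite orbT.
have bnd n (x : borel X) :
    \int[nstep P n x]_y (V y)%:E <= (l ^+ n * V x + c * (1 - l ^+ n))%:E.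
  elim: n x => [|n ih] x.
    rewrite /= /kdirac integral_dirac// diracT mul1e expr0 mul1r subrr mulr0 addr0.
    by [].
  have ln0 : (0 <= l ^+ n)%R by rewrite exprn_ge0.
  have ln1 : (l ^+ n <= 1)%R by rewrite exprn_ile1// -subr_ge0 ltW.
  rewrite ge0_integral_nstepS//.
  apply: (@le_trans _ _ (\int[P x]_y ((l ^+ n)%:E * (V y)%:E + (c * (1 - l ^+ n))%:E))).
    apply: ge0_le_integral => //.
    - by move=> y _; exact: integral_ge0.
    - apply: measurable_fun_integral_kernel => // U mU; exact: measurable_kernel.
    - by apply: emeasurable_funD => //; exact: measurable_funeM.
  rewrite ge0_integralD//; last 3 first.
  - by move=> y _; rewrite mule_ge0.
  - exact: measurable_funeM.
  - by move=> y _; rewrite lee_fin mulr_ge0// subr_ge0.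
  rewrite ge0_integralZl_EFin// integral_cst//.
  apply: (@le_trans _ _ ((l ^+ n)%:E * (l * V x + c * (1 - l))%:E +
      (c * (1 - l ^+ n))%:E)).
    rewrite prob_kernel mule1 leeD2r//; apply: lee_pmul => //; exact: integral_ge0.
  rewrite -EFinM -EFinD lee_fin exprSr.
  by rewrite le_eqVlt; apply/orP; left; apply/eqP; ring.
exists c => n x; apply: (le_trans (bnd n x)); rewrite lee_fin lerD//.
  by rewrite ler_piMl// exprn_ile1// -subr_ge0 ltW.
by rewrite ler_piMr// lerBlDr lerDl exprn_ge0.
Qed.

Local Open Scope ring_scope.

Definition cutoff (x' : X) (s : R) (y : X) : R := clamp (s + 1 - mdist x' y).

Lemma bcont_cutoff x' s : bcont (cutoff x' s).
Proof.
apply: bcont_clamp => y; apply: cvgB; first exact: cvg_cst.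
exact: continuous_mdist.
Qed.

(** Markov's inequality for [V]: at distance more than [s] from [x'] one has [V > A], hence
    [1 - cutoff x' s <= V / A]. On the ball of radius [d] the function [V] exceeds [V x] by at most
    1, whence the value of [A]. *)
Lemma lyapunov_tail : exists x', forall x e, 0 < e -> exists s, exists2 d, 0 < d &
  forall y, ball x d y -> forall n, nexp P n (fun w => 1 - cutoff x' s w) y <= e.
Proof.
have [c Vc] := lyapunov_nstep; have [cV V0 [x' Vx']] := lyapV.
have c0 (y : X) : 0 <= V y + c.
  have := Vc 0%N y; rewrite -lee_fin; apply: le_trans; apply: integral_ge0 => w _.
  by rewrite lee_fin.
exists x' => x e e0; pose A := (V x + 1 + c) / e.
have A0 : 0 < A by rewrite divr_gt0// -addrA (addrC 1) addrA ltr_pwDr.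
have [s sV] := Vx' A; exists s.
have [d d0 Vd] := continuous_ball x cV (@ltr01 R); exists d => // y /Vd Vy n.
have bc : @bmeas _ (borel X) R (fun w => 1 - cutoff x' s w).
  by apply/bcont_bmeas/bcontB; [exact: bcont_cst|exact: bcont_cutoff].
rewrite -lee_fin -integralE_bmeas//; last exact: nstep_setT.
apply: (@le_trans _ _ (\int[nstep P n y]_w (A^-1%:E * (V w)%:E)))%E.
  apply: ge0_le_integral => //.
  - by move=> w _; rewrite lee_fin subr_ge0 clamp_le1.
  - by apply/measurable_EFinP; case: bc.
  - by apply: measurable_funeM; apply/measurable_EFinP; exact: continuous_measurable_borel.
  - move=> w _; rewrite -EFinM lee_fin.
    have [ws|ws] := leP (mdist x' w) s.
      by rewrite /cutoff clamp_eq1 ?subrr ?mulr_ge0 ?invr_ge0 ?(ltW A0)//; lra.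
    rewrite (@le_trans _ _ 1)//; first by rewrite lerBlDr lerDl clamp_ge0.
    by rewrite ler_pdivlMl// mulr1 ltW// sV// metric_sym.
rewrite ge0_integralZl_EFin//; last 3 first.
- by move=> w _; rewrite lee_fin.
- by apply/measurable_EFinP; exact: continuous_measurable_borel.
- by rewrite invr_ge0 ltW.
apply: (@le_trans _ _ (A^-1%:E * (V y + c)%:E)%E).
  by rewrite lee_pmul ?lee_fin ?invr_ge0 ?(ltW A0)//; apply: integral_ge0 => w _; rewrite lee_fin.
rewrite -EFinM lee_fin ler_pdivrMl// /A divfK ?gt_eqF//.
by move: Vy; rewrite ler_norml => /andP[_]; lra.
Qed.

End lyapunov_bound.

Section equicontinuity.
Context {R : realType} {X : completeMetricType R}.
Variable P : R.-pker (borel X) ~> (borel X).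
Local Open Scope ring_scope.

(** Time [n = 0] is included; for [f] in [bcont] it amounts to continuity of [f]. *)
Definition equicont (f : X -> R) := forall x e, 0 < e -> exists2 d, 0 < d &
  forall y, ball x d y -> forall n, `|nexp P n f y - nexp P n f x| <= e.

(* A failure of equicontinuity at [x] along [u k --> x] would contradict
   equicontinuity on the compact set formed by [x] and the [u k]. *)
Lemma equicont_Cb f : e_chain P -> Cb f -> equicont f.
Proof.
move=> eP Cf; have [cf bdf _] := Cf.
have bf : bounded_by f.
  have [M [_ fM]] := bdf; exists (`|M| + 1) => x; apply: fM => //.
  by rewrite ltr_pwDr// ler_norm.
have bmf : bmeas (f : borel X -> R) by exact: bcont_bmeas.
move=> x e e0; apply: contrapT => nd.
have yP (k : nat) : exists y, ball x k.+1%:R^-1 y /\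
    exists2 n, (0 < n)%N & ~ `|nexp P n f y - nexp P n f x| <= e.
  have [d d0 fd] := continuous_ball x cf e0.
  apply: contrapT => /forallNP ny; apply: nd; exists (Num.min d k.+1%:R^-1).
    by rewrite lt_min d0/= invr_gt0.
  move=> y xy n; case: n => [|n].
    by rewrite !nexp0//; apply: fd; apply: le_ball xy; rewrite ge_min lexx.
  apply: contrapT => yn; apply: (ny y); split; last by exists n.+1.
  by apply: le_ball xy; rewrite ge_min lexx orbT.
have /choice[u uP] := yP.
have ux : u k @[k --> \oo] --> x.
  apply/cvg_ballP => d d0; near=> k.
  apply: le_ball (uP k).1; apply: ltW; near: k.
  exact: (near_infty_natSinv_lt (PosNum d0)).
have cK := compact_cvg_seq ux.
set K := x |` range u in cK.
have entE : entourage [set ab : R * R | `|ab.2 - ab.1| <= e].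
  rewrite -entourage_ballE; exists e => //= -[a c]/=.
  by rewrite /ball/= distrC => /ltW.
have Kx : K x by left.
have := eP f Cf K cK (x : subspace K) _ entE.
rewrite /prop_near1 /nbhs/= -(nbhs_subspace_in Kx) => /nbhs_ballP[d /= d0 dP].
have [k kd] : exists k : nat, k.+1%:R^-1 <= d.
  near \oo%classic => k; exists k; apply: ltW; near: k.
  exact: (near_infty_natSinv_lt (PosNum d0)).
have [xuk [n n0 nle]] := uP k.
apply: nle; apply: (dP (u k)) => //; last by right; exists k.
exact: le_ball xuk.
Unshelve. all: by end_near. Qed.

Hypothesis tail : exists x', forall x e, 0 < e -> exists s, exists2 d, 0 < d &
  forall y, ball x d y -> forall n, nexp P n (fun w => 1 - cutoff x' s w) y <= e.

(** The product of [f] with a cutoff lies in [Cb] and differs from [f] by at most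
    [M * (1 - cutoff x' s)], whose integrals are small at all times and all points near [x]. *)
Lemma equicont_bcont f : e_chain P -> bcont f -> equicont f.
Proof.
move=> eP bf x e e0; have [x' xP] := tail; have [cf [M0 fM0]] := bf.
pose M := `|M0| + 1; have M_gt0 : 0 < M by rewrite ltr_pwDr.
have fM y : `|f y| <= M by rewrite (le_trans (fM0 y))// ler_wpDr// ler_norm.
have e4 : 0 < e / 3 / M by rewrite !divr_gt0.
have e3 : 0 < e / 3 by rewrite divr_gt0.
have [s [d d0 sd]] := xP x _ e4.
have bg : bcont (fun w => f w * cutoff x' s w) by apply: bcontM => //; exact: bcont_cutoff.
have Cg : Cb (fun w => f w * cutoff x' s w).
  case: bg => cg [N gN]; split => //.
    exists N; split; first exact: num_real.
    by move=> N' NN' y _ /=; rewrite (le_trans (gN y))// ltW.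
  exists x', (s + 2) => y /(_ (ball y 1)) []; first exact: nbhsx_ballx.
  move=> w [/= gw]; rewrite !ballEmdist/= => yw.
  have x'w : mdist x' w < s + 1.
    rewrite ltNge; apply: contra gw => ws.
    by rewrite /cutoff clamp_eq0 ?mulr0// subr_le0.
  have := metric_triangle x' w y; rewrite (metric_sym w); lra.
have [d' d'0 gd'] := equicont_Cb eP Cg x e3.
have near_g y : ball x d y -> forall n,
    `|nexp P n f y - nexp P n (fun w => f w * cutoff x' s w) y| <= e / 3.
  move=> xy n; have bc := bcont_cutoff x' s.
  rewrite -nexpB; [|exact: bcont_bmeas|exact: bcont_bmeas].
  have bh : bcont (fun w => 1 - cutoff x' s w) by apply: bcontB => //; exact: bcont_cst.
  have bm : @bmeas _ (borel X) R (fun w => M * (1 - cutoff x' s w)).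
    by apply: bmeasZ; exact: bcont_bmeas.
  have -> : e / 3 = M * (e / 3 / M) by field; rewrite gt_eqF.
  have le_M : M * nexp P n (fun w => 1 - cutoff x' s w) y <= M * (e / 3 / M).
    by rewrite ler_wpM2l ?(ltW M_gt0)// sd.
  have bfg : @bmeas _ (borel X) R (fun w => f w - f w * cutoff x' s w).
    by apply: bcont_bmeas; exact: bcontB.
  have bfgN : @bmeas _ (borel X) R (fun w => - 1 * (f w - f w * cutoff x' s w)).
    exact: bmeasZ.
  have pt w : `|f w - f w * cutoff x' s w| <= M * (1 - cutoff x' s w).
    rewrite -{1}(mulr1 (f w)) -mulrBr normrM ler_pM// ger0_norm// subr_ge0.
    exact: clamp_le1.
  rewrite ler_norml; apply/andP; split.
    rewrite lerNl -mulN1r -nexpZ// (le_trans _ le_M)// -nexpZ; last exact: bcont_bmeas.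
    apply: nexp_le => // w; rewrite mulN1r.
    by rewrite (le_trans _ (pt w))// -normrN ler_norm.
  rewrite (le_trans _ le_M)// -nexpZ; last exact: bcont_bmeas.
  by apply: nexp_le => // w; rewrite (le_trans _ (pt w))// ler_norm.
exists (Num.min d d'); first by rewrite lt_min d0.
move=> y xy n.
have xyd : ball x d y by apply: le_ball xy; rewrite ge_min lexx.
have xyd' : ball x d' y by apply: le_ball xy; rewrite ge_min lexx orbT.
have := gd' y xyd' n; have := near_g y xyd n; have := near_g x (ballxx _ d0) n.
rewrite !ler_norml => /andP[? ?] /andP[? ?] /andP[? ?]; apply/andP; split; lra.
Qed.

End equicontinuity.

(** * Tightness of the laws started at [z] *)

Lemma half_exprn_le (R : realType) (e : R) : (0 < e)%R -> exists n, (2^-1 ^+ n <= e)%R.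
Proof.
move=> e0; have : ((2^-1 ^+ i)%R : R) @[i --> \oo] --> 0%R.
  by apply: cvg_expr; rewrite ger0_norm// invf_lt1// ltr1n.
move=> /cvgrPdist_le/(_ _ e0)[i _ /(_ i (leqnn _))].
by rewrite sub0r normrN => /(le_trans (ler_norm _)) ie; exists i.
Qed.

Section tightness.
Context {R : realType} {X : completeMetricType R}.
Variables (P : R.-pker (borel X) ~> (borel X)) (z : X).
Local Open Scope ring_scope.
Hypothesis equicP : forall f, bcont f -> equicont P f.
Hypothesis recurrent : forall (r : R) (x : X), 0 < r -> exists2 a : R, 0 < a &
  exists N, forall n, (N <= n)%N -> a <= nexp P n (tent z r) x.

Variable w : X -> R.
Hypothesis cw : continuous w.
Hypothesis w0 : forall x, 0 < w x.

(** A continuous substitute for the indicator of [{w <= c}], so that equicontinuity applies to it;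
    the price is that it vanishes only from level [2 * c] on. *)
Definition low c (x : X) : R := clamp (2 - w x / c).

Lemma bcont_low c : bcont (low c).
Proof.
apply: bcont_clamp => y; apply: cvgB; first exact: cvg_cst.
by apply: cvgMr_tmp; exact: cw.
Qed.

Lemma low_eq1 c x : 0 < c -> w x <= c -> low c x = 1.
Proof. by move=> c0 wc; apply: clamp_eq1; rewrite lerBrDr -lerBrDl ler_pdivrMr//; lra. Qed.

Lemma low_eq0 c x : 0 < c -> 2 * c <= w x -> low c x = 0.
Proof. by move=> c0 wc; apply: clamp_eq0; rewrite subr_le0 ler_pdivlMr. Qed.

Lemma clamp_le s t : s <= t -> clamp s <= clamp t :> R.
Proof.
move=> st; rewrite /clamp ge_max !le_max lexx/=; apply/orP; right.
by rewrite le_min ge_min lexx/= ge_min st orbT.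
Qed.

Lemma low_le c c' x : 0 < c -> c <= c' -> low c x <= low c' x.
Proof.
move=> c0 cc'; apply: clamp_le; rewrite lerD2l lerN2 ler_wpM2l//; first exact: ltW.
by rewrite lef_pV2// posrE// (lt_le_trans c0).
Qed.

(** Dominated convergence, as [w] is positive everywhere. Here [c] depends on [n] and [x]; making it
    independent of the time is the purpose of [tight]. *)
Lemma low_vanishes n x k : 0 < k -> exists2 c, 0 < c &
  forall c', 0 < c' -> c' <= c -> nexp P n (low c') x <= k.
Proof.
move=> k0.
have : nexp P n (low j.+1%:R^-1) x @[j --> \oo] --> nexp P n (fun=> 0) x.
  apply: (bintegral_cvg (nstep_setT P n x) (M := 1)).
  - by move=> j; exact/bcont_bmeas/bcont_low.
  - exact: bmeas_cst.
  - by move=> j y; rewrite ger0_norm ?clamp_ge0// clamp_le1.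
  - apply: aeW => y; apply: cvg_near_cst.
    have wy : 0 < w y / 2 by rewrite divr_gt0.
    near=> j; apply/eqP; rewrite low_eq0//.
    rewrite mulrC -ler_pdivlMr//; apply: ltW; near: j.
    exact: (near_infty_natSinv_lt (PosNum wy)).
rewrite nexp_cst => /cvgrPdist_le/(_ _ k0)[j _ /(_ j (leqnn _))].
rewrite sub0r normrN => /(le_trans (ler_norm _)) jk.
exists j.+1%:R^-1; first by rewrite invr_gt0.
move=> c' c'0 c'j; apply: (le_trans _ jk).
by apply: nexp_le => [||y]; [exact/bcont_bmeas/bcont_low|exact/bcont_bmeas/bcont_low|
  exact: low_le].
Unshelve. all: by end_near. Qed.

(** Below level [c] there is room for further summands: adding a function that lives there keeps the
    sum between 0 and 1. *)
Definition layer c f := [/\ bcont f, forall x, 0 <= f x <= 1 &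
  forall x, w x <= c -> f x = 0].

(* If the conclusion of [equicont_layers] fails, one superposes functions living
   on layers of [w] ever closer to [0], each of them showing the failure at a
   point ever closer to [z].  The layers are chosen so thin and so far apart that
   the other summands hardly contribute, hence the sum is not equicontinuous. *)
Section gliding_hump.
Variable k : R.
Hypothesis k0 : 0 < k.
Hypothesis not_uniform : forall d c : R, 0 < d -> 0 < c -> exists f y n,
  [/\ exists2 c' : R, 0 < c' & layer c' f, forall x, c <= w x -> f x = 0, ball z d y &
      k < `|nexp P n f y - nexp P n f z|].

(** A state holds a partial sum, a level below which it vanishes, and the point and time at which
    the last summand [F' - F] shows the failure. The old sum varies little there by equicontinuity;
    the mass of [low c'] bounds all later summands. The validity of the old state is a premise so
    that every state has a successor, as dependent choice requires. *)
Let hump (s s' : (X -> R) * R * (X * nat)) :=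
  let '(F, c, _) := s in let '(F', c', (y, n)) := s' in
  0 < c -> layer c F ->
  [/\ 0 < c', layer c' F', c' <= c / 2, forall x, c <= w x -> F' x = F x &
    [/\ ball z c y, k < `|nexp P n (fun x => F' x - F x) y - nexp P n (fun x => F' x - F x) z|,
      `|nexp P n F y - nexp P n F z| <= k / 4,
      nexp P n (low c') y <= k / 4 & nexp P n (low c') z <= k / 4]].

Let next_hump s : {s' | hump s s'}.
Proof.
apply: cid; case: s => -[F c] s2.
have [c0|/negP c0] := boolP (0 < c); last by exists (F, c, (z, 0%N)).
have [lF|nl] := pselect (layer c F); last by exists (F, c, (z, 0%N)).
have [bF F01 Fc] := lF.
have k4 : 0 < k / 4 by rewrite divr_gt0.
have [d d0 Fd] := equicP bF z k4.
have dc0 : 0 < Num.min d c by rewrite lt_min d0.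
have [f [y [n [[c' c'0 [bf f01 fc']] fc zy fk]]]] := not_uniform dc0 c0.
have [c1 c10 lowy] := low_vanishes n y k4.
have [c2 c20 lowz] := low_vanishes n z k4.
pose c3 := Num.min (Num.min c' (c / 2)) (Num.min c1 c2).
have c30 : 0 < c3 by rewrite !lt_min c'0 divr_gt0//= c10.
exists (fun x => F x + f x, c3, (y, n)) => _ _.
have FfE : (fun x => F x + f x - F x) = f by apply/funext => x; rewrite addrAC subrr add0r.
have c3c' : c3 <= c' by rewrite !ge_min lexx.
have c3c : c3 <= c / 2 by rewrite !ge_min lexx orbT.
split => //.
- split; first exact: bcontD.
  + move=> x; have [wc|/ltW wc] := leP (w x) c; first by rewrite Fc// add0r.
    by rewrite fc// addr0.
  + move=> x wx; rewrite fc'; last exact: le_trans wx c3c'.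
    by rewrite addr0 Fc// (le_trans wx)// (le_trans c3c)// ler_pdivrMr//; lra.
- by move=> x /fc ->; rewrite addr0.
- rewrite FfE; split => //.
  + by apply: le_ball zy; rewrite ge_min lexx orbT.
  + by apply: Fd; apply: le_ball zy; rewrite ge_min lexx.
  + by apply: lowy => //; rewrite !ge_min lexx ?orbT.
  + by apply: lowz => //; rewrite !ge_min lexx ?orbT.
Qed.

Lemma gliding_hump : False.
Proof.
have [s [s0 sP]] := dependent_choice next_hump (fun=> 0, 1, (z, 0%N)).
pose F i := (s i).1.1; pose c i := (s i).1.2; pose y i := (s i).2.1; pose m i := (s i).2.2.
have sE i : s i = (F i, c i, (y i, m i)).
  by rewrite /F /c /y /m; case: (s i) => -[? ?] [? ?].
have inv i : 0 < c i /\ layer (c i) (F i).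
  elim: i => [|i [ci li]].
    rewrite /c /F s0/=; split; [exact: ltr01|split => //; first exact: bcont_cst].
    by move=> x; rewrite lexx ler01.
  by have := sP i; rewrite !sE => /(_ ci li)[].
have step i : [/\ c i.+1 <= c i / 2, forall x, c i <= w x -> F i.+1 x = F i x &
    [/\ ball z (c i) (y i.+1), k < `|nexp P (m i.+1) (fun x => F i.+1 x - F i x) (y i.+1)
      - nexp P (m i.+1) (fun x => F i.+1 x - F i x) z|,
      `|nexp P (m i.+1) (F i) (y i.+1) - nexp P (m i.+1) (F i) z| <= k / 4,
      nexp P (m i.+1) (low (c i.+1)) (y i.+1) <= k / 4 &
      nexp P (m i.+1) (low (c i.+1)) z <= k / 4]].
  by have [ci li] := inv i; have := sP i; rewrite !sE => /(_ ci li)[].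
have c_small e : 0 < e -> exists i, c i <= e.
  have ci i : c i <= 2^-1 ^+ i.
    elim: i => [|i ih]; first by rewrite /c s0 expr0.
    have [le_c _ _] := step i; rewrite (le_trans le_c)// exprSr ler_wpM2r//.
  by move=> /half_exprn_le[i ie]; exists i; rewrite (le_trans (ci i)).
have c_nonincr i j : (i <= j)%N -> c j <= c i.
  elim: j => [|j ih]; first by rewrite leqn0 => /eqP ->.
  rewrite leq_eqVlt => /predU1P[->//|]; rewrite ltnS => /ih; apply: le_trans.
  have [le_c _ _] := step j; rewrite (le_trans le_c)//.
  by have [cj _] := inv j; rewrite ler_pdivrMr//; lra.
have F_stable i j x : (i <= j)%N -> c i <= w x -> F j x = F i x.
  move=> ij ciw; elim: j ij => [|j ih]; first by rewrite leqn0 => /eqP ->.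
  rewrite leq_eqVlt => /predU1P[->//|]; rewrite ltnS => ij.
  have [_ Fj _] := step j; rewrite Fj ?ih//.
  exact: le_trans (c_nonincr _ _ ij) ciw.
(* As [w x > 0], the partial sums are eventually constant at each point, by [F_stable]; [f] is their
   limit, and near a given point it coincides with a single [F i]. *)
pose f x := F (projT1 (cid (c_small _ (w0 x)))) x.
have fE i x : c i <= w x -> f x = F i x.
  rewrite /f; case: (cid _) => j /= cj ci.
  by have [ij|/ltnW ij] := leqP i j; rewrite (F_stable _ _ _ ij).
have f01 x : 0 <= f x <= 1 by have [_ [_ + _]] := inv (projT1 (cid (c_small _ (w0 x)))); exact.
have bf : bcont f.
  split; last by exists 1 => x; have /andP[? ?] := f01 x; rewrite ger0_norm.
  move=> x; have wx2 : 0 < w x / 2 by rewrite divr_gt0.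
  have [i ciw] := c_small _ wx2.
  have [_ [[cS _] _ _]] := inv i.
  have [d d0 wd] := continuous_ball x cw wx2.
  have near_c : \forall x' \near x, F i x' = f x'.
    apply/nbhs_ballP; exists d => // x' /wd; rewrite ler_norml => /andP[+ _] => wx'.
    by rewrite (fE i)//; lra.
  rewrite /continuous_at (fE i); last lra.
  move=> A /cS FA; rewrite nbhs_simpl/=.
  by apply: filterS2 near_c FA => x' /= ->.
have k4 : 0 < k / 4 by rewrite divr_gt0.
have [d d0 fd] := equicP bf z k4.
have [i cid] := c_small _ d0.
have [_ FF [zy hk Fk lowy lowz]] := step i.
have [_ [bF F01 Fc]] := inv i; have [ci1 [bF' F'01 F'c]] := inv i.+1.
have := fd (y i.+1) (le_ball cid zy) (m i.+1).
set n := m i.+1 in hk Fk lowy lowz *.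
have bm g : bcont g -> @bmeas _ (borel X) R g by exact: bcont_bmeas.
have bD : bcont (fun x => F i.+1 x - F i x) by exact: bcontB.
have bT : bcont (fun x => f x - F i.+1 x) by exact: bcontB.
(* Between [y i.+1] and [z] the three terms vary by at most [k / 4], by more than [k] and by at most
   [k / 4]; hence [f] varies by more than [k / 2], against the bound [k / 4] of [fd]. *)
have decomp x : nexp P n f x = nexp P n (F i) x + nexp P n (fun x => F i.+1 x - F i x) x
    + nexp P n (fun x => f x - F i.+1 x) x.
  rewrite -nexpDl; [|exact: bm|exact: bm].
  rewrite -nexpDl; [|by apply: bm; exact: bcontD|exact: bm].
  by congr nexp; apply/funext => x'; ring.
have tail_ge0 x : 0 <= nexp P n (fun x => f x - F i.+1 x) x.
  apply: nexp_ge_cst; first exact: bm.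
  move=> x'; have [wc|/ltW wc] := leP (c i.+1) (w x'); first by rewrite (fE _ _ wc) subrr.
  by rewrite F'c// subr0; have /andP[] := f01 x'.
have tail_le x : nexp P n (fun x => f x - F i.+1 x) x <= nexp P n (low (c i.+1)) x.
  apply: nexp_le; [exact: bm|by apply: bm; exact: bcont_low|].
  move=> x'; have [wc|/ltW wc] := leP (c i.+1) (w x').
    by rewrite (fE _ _ wc) subrr clamp_ge0.
  by rewrite F'c// subr0 low_eq1//; have /andP[] := f01 x'.
clear s0; rewrite !decomp; move: hk Fk lowy lowz (tail_ge0 z) (tail_ge0 (y i.+1))
  (tail_le z) (tail_le (y i.+1)).
rewrite ltr_normr => /orP[] ?; rewrite !ler_norml => /andP[? ?] ? ? ? ? ? ? /andP[? ?]; lra.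
Qed.

End gliding_hump.

(** For a single [f] this is equicontinuity at [z]; the point is that [d] and [c] serve all layers
    below level [c] at once. *)
Lemma equicont_layers k : 0 < k -> exists d c : R, [/\ 0 < d, 0 < c &
  forall f (c' : R), 0 < c' -> layer c' f -> (forall x, c <= w x -> f x = 0) ->
  forall y, ball z d y -> forall n, `|nexp P n f y - nexp P n f z| <= k].
Proof.
move=> k0; apply: contrapT => nd; apply: (gliding_hump k0) => d c d0 c0.
apply: contrapT => nf; apply: nd; exists d, c; split => // f c' c'0 lf fc y zy n.
apply: contrapT => /negP; rewrite -ltNge => kf; apply: nf.
by exists f, y, n; split => //; exists c'.
Qed.

(* Otherwise there are arbitrarily many disjoint layers each charged at some time.
   By [equicont_layers], each of them is charged, up to a common factor, from all
   points near [z]; since the chain comes back there, at large times every layer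
   has at least some fixed mass, and the total mass exceeds [1]. *)
Lemma tight k : 0 < k -> exists2 c : R, 0 < c & forall m, nexp P m (low c) z <= k.
Proof.
move=> k0; apply: contrapT => nc.
have heavy (c : R) : 0 < c -> exists m, k < nexp P m (low c) z.
  move=> c0; apply: contrapT => nm; apply: nc; exists c => // m.
  by apply: contrapT => /negP; rewrite -ltNge => km; apply: nm; exists m.
have k4 : 0 < k / 4 by rewrite divr_gt0.
have [d [c0 [d0 c00 layerP]]] := equicont_layers k4.
have [a a0 [N aN]] := recurrent z d0.
have bm g : bcont g -> @bmeas _ (borel X) R g by exact: bcont_bmeas.
have sum_layers M : exists g (c : R), [/\ 0 < c, c <= c0, layer c g &
    exists m0, forall m, (m0 <= m)%N -> M%:R * (a * (k / 4)) <= nexp P m g z].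
  elim: M => [|M [g [c [c_gt0 cc0 lg [m0 gm0]]]]].
    exists (fun=> 0), c0; split => //.
      by split => //; [exact: bcont_cst|move=> x; rewrite lexx ler01].
    by exists 0%N => m _; rewrite mul0r nexp_cst.
  have [bg g01 gc] := lg.
  have c2 : 0 < c / 2 by rewrite divr_gt0.
  have [m km] := heavy _ c2.
  have k2 : 0 < k / 2 by rewrite divr_gt0.
  have [c1 c1_gt0 lowc1] := low_vanishes m z k2.
  pose c' := Num.min c1 (c / 2).
  have c'0 : 0 < c' by rewrite lt_min c1_gt0.
  have c'c : c' <= c / 2 by rewrite ge_min lexx orbT.
  have c'c1 : c' <= c1 by rewrite ge_min lexx.
  (* At time [m] this layer has mass more than [k - k / 2] from [z]; [equicont_layers] costs
     [k / 4], so at least [k / 4] is left from every point of the ball. With the factor [a] for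
     being in that ball, each layer contributes [a * (k / 4)]. *)
  pose f x := low (c / 2) x - low c' x.
  have bf : bcont f by apply: bcontB; exact: bcont_low.
  have f0 x : 0 <= f x by rewrite subr_ge0 low_le.
  have f1 x : f x <= 1 by rewrite lerBlDr (le_trans (clamp_le1 _))// lerDl clamp_ge0.
  have fc' x : w x <= c' -> f x = 0.
    by move=> wx; rewrite /f !low_eq1 ?subrr// (le_trans wx).
  have fc x : c <= w x -> f x = 0.
    by move=> wx; rewrite /f !low_eq0 ?subrr//; lra.
  have lf : layer c' f by split => // x; rewrite f0 f1.
  have fy y : k / 4 * tent z d y <= nexp P m f y.
    have [zy|zy] := pselect (ball z d y); last first.
      by rewrite tent_eq0// mulr0; apply: nexp_ge_cst => //; exact: bm.
    apply: (@le_trans _ _ (k / 4)); first by rewrite ler_piMr ?(ltW k4)// tent_le1.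
    have := layerP f c' c'0 lf (fun x cx => fc x (le_trans cc0 cx)) y zy m.
    have -> : nexp P m f z = nexp P m (low (c / 2)) z - nexp P m (low c') z.
      by rewrite nexpB//; exact/bm/bcont_low.
    have := lowc1 c' c'0 c'c1; move: km; rewrite ler_norml => ? ? /andP[? _]; lra.
  have fm n : (N + m <= n)%N -> a * (k / 4) <= nexp P n f z.
    move=> Nmn; rewrite -(@subnK m n); last exact: leq_trans (leq_addl _ _) Nmn.
    rewrite nexpD; last exact: bm.
    apply: (@le_trans _ _ (nexp P (n - m) (fun y => k / 4 * tent z d y) z)).
      rewrite nexpZ; last by apply: bm; exact: bcont_tent.
      rewrite mulrC ler_wpM2l ?(ltW k4)// aN//.
      by rewrite leq_subRL ?(leq_trans (leq_addl _ _) Nmn)// addnC.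
    by apply: nexp_le => //; [apply/bm/bcontZ; exact: bcont_tent|exact/bmeas_nexp/bm].
  exists (fun x => g x + f x), c'; split => //.
  - by rewrite (le_trans c'c)// (le_trans _ cc0)// ler_pdivrMr//; lra.
  - split; first exact: bcontD.
    + move=> x; have [wc|/ltW wc] := leP (w x) c.
        by rewrite gc// add0r f0 f1.
      by rewrite fc// addr0.
    + by move=> x wx; rewrite fc'// gc ?addr0// (le_trans wx)// (le_trans c'c)// ler_pdivrMr//; lra.
  - exists (maxn m0 (N + m)) => n; rewrite geq_max => /andP[m0n Nmn].
    rewrite nexpDl; [|exact: bm|exact: bm].
    by rewrite -natr1 mulrDl mul1r lerD ?gm0 ?fm.
have ak0 : 0 < a * (k / 4) by rewrite mulr_gt0.
have [g [c [_ _ [bg g01 _] [m0 /(_ m0 (leqnn _))]]]] := sum_layers (Num.truncn (a * (k / 4))^-1).+1.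
apply/negP; rewrite -ltNge; apply: (@le_lt_trans _ _ 1).
  by apply: nexp_le_cst => [|x]; [exact: bm|have /andP[] := g01 x].
by rewrite -ltr_pdivrMr// mul1r truncnS_gt.
Qed.

End tightness.

(** * Dini's argument and recurrence uniform up to a small mass *)

Section sup_distance.
Context {R : realType}.
Local Open Scope ring_scope.
Implicit Types a b : nat -> R.

Definition unit_valued a := forall k, 0 <= a k <= 1.

Lemma unit_valued_has_sup a : unit_valued a -> has_sup (range a).
Proof.
by move=> a01; split; [exists (a 0%N), 0%N|exists 1 => _ [k _ <-]; have /andP[] := a01 k].
Qed.

Lemma unit_valued_has_inf a : unit_valued a -> has_inf (range a).
Proof.
by move=> a01; split; [exists (a 0%N), 0%N|exists 0 => _ [k _ <-]; have /andP[] := a01 k].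
Qed.

Lemma sup_ge a k : unit_valued a -> a k <= sup (range a).
Proof. by move=> a01; apply: ub_le_sup; [case: (unit_valued_has_sup a01)|exists k]. Qed.

Lemma inf_le a k : unit_valued a -> inf (range a) <= a k.
Proof. by move=> a01; apply: ge_inf; [case: (unit_valued_has_inf a01)|exists k]. Qed.

(** Suprema do not increase the uniform distance, which makes the supremum of an equicontinuous
    family continuous; likewise for infima. *)
Lemma sup_dist a b e : unit_valued a -> unit_valued b ->
  (forall k, `|a k - b k| <= e) -> `|sup (range a) - sup (range b)| <= e.
Proof.
have half c d : unit_valued c -> unit_valued d -> (forall k, `|c k - d k| <= e) ->
    sup (range c) - sup (range d) <= e.
  move=> c01 d01 cd; rewrite lerBlDr; apply: ge_sup; first by exists (c 0%N), 0%N.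
  move=> _ [k _ <-]; have := cd k; rewrite ler_norml => /andP[_].
  have := sup_ge k d01; lra.
move=> a01 b01 ab; rewrite ler_norml lerNl opprB; apply/andP; split; apply: half => // k.
by rewrite distrC.
Qed.

Lemma inf_dist a b e : unit_valued a -> unit_valued b ->
  (forall k, `|a k - b k| <= e) -> `|inf (range a) - inf (range b)| <= e.
Proof.
have half c d : unit_valued c -> unit_valued d -> (forall k, `|c k - d k| <= e) ->
    inf (range d) - inf (range c) <= e.
  move=> c01 d01 cd; rewrite lerBlDr -lerBlDl; apply: lb_le_inf; first by exists (c 0%N), 0%N.
  move=> _ [k _ <-]; have := cd k; rewrite ler_norml => /andP[? ?].
  have := inf_le k d01; lra.
move=> a01 b01 ab; rewrite ler_norml lerNl opprB; apply/andP; split; apply: half => // k.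
by rewrite distrC.
Qed.

End sup_distance.

Section dini.
Context {R : realType} {X : completeMetricType R}.
Variables (P : R.-pker (borel X) ~> (borel X)) (z : X).
Local Open Scope ring_scope.
Hypothesis equicP : forall f, bcont f -> equicont P f.
Hypothesis recurrent : forall (r : R) (x : X), 0 < r -> exists2 a : R, 0 < a &
  exists N, forall n, (N <= n)%N -> a <= nexp P n (tent z r) x.

Lemma continuous_ball_nat (h : nat -> X -> R) n x e : (forall k, continuous (h k)) -> 0 < e ->
  exists2 d, 0 < d & forall y, ball x d y -> forall k, (k < n)%N -> `|h k y - h k x| <= e.
Proof.
move=> ch e0; elim: n => [|n [d d0 dP]]; first by exists 1.
have [d' d'0 d'P] := continuous_ball x (ch n) e0.
exists (Num.min d d'); first by rewrite lt_min d0.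
move=> y xy k; rewrite ltnS leq_eqVlt => /predU1P[->|kn].
  by apply: d'P; apply: le_ball xy; rewrite ge_min lexx orbT.
by apply: dP => //; apply: le_ball xy; rewrite ge_min lexx.
Qed.

(** Tightness is applied to [w = sup_i 2^-i h_i], positive, and continuous because its far terms are
    uniformly small. If [2^-Q <= c], then [h Q x <= c] forces [w x <= c]: the terms up to [Q] are
    bounded by monotonicity, the later ones by their weight. *)
Lemma dini (h : nat -> X -> R) k : (forall i, continuous (h i)) ->
  (forall i x, 0 <= h i x <= 1) -> (forall i j x, (i <= j)%N -> h i x <= h j x) ->
  (forall x, exists i, 0 < h i x) -> 0 < k ->
  exists Q (c : R) l, [/\ 0 < c, bcont l, forall x, 0 <= l x <= 1,
    forall x, h Q x <= c -> l x = 1 & forall m, nexp P m l z <= k].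
Proof.
move=> ch h01 nd_h h_gt0 k0.
pose a x i := 2^-1 ^+ i * h i x.
have half_le1 i : 2^-1 ^+ i <= 1 :> R.
  by rewrite exprn_ile1// invf_le1// ler1n.
have half_ge0 i : 0 <= 2^-1 ^+ i :> R by rewrite exprn_ge0.
have a01 x : unit_valued (a x).
  move=> i; have /andP[h0 h1] := h01 i x.
  by rewrite mulr_ge0//= -[leRHS](mulr1 1) ler_pM.
pose w x := sup (range (a x)).
have w_gt0 x : 0 < w x.
  have [i hi] := h_gt0 x; apply: (lt_le_trans _ (sup_ge i (a01 x))).
  by rewrite mulr_gt0// exprn_gt0.
have cw : continuous w.
  apply/continuous_epsP => x e e0; have [n ne] := half_exprn_le e0.
  have [d d0 dP] := continuous_ball_nat n x ch e0; exists d => // y xy.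
  apply: sup_dist => // i; rewrite /a -mulrBr normrM ger0_norm//.
  have [ni|ni] := ltnP i n.
    by rewrite (le_trans _ (dP y xy _ ni))// ler_piMl.
  rewrite (@le_trans _ _ (2^-1 ^+ i * 1))//.
    rewrite ler_wpM2l// ler_norml.
    have := h01 i x; have := h01 i y; lra.
  rewrite mulr1 (le_trans _ ne)//.
  by rewrite ler_wiXn2l// ?invr_ge0// invf_le1// ler1n.
have [c c0 cP] := tight equicP recurrent cw w_gt0 k0.
have [Q Qc] := half_exprn_le c0.
exists Q, c, (low w c); split => //.
- exact: bcont_low.
- by move=> x; rewrite clamp_ge0 clamp_le1.
move=> x hQ; apply: low_eq1 => //; apply: ge_sup; first by exists (a x 0%N), 0%N.
move=> _ [i _ <-]; have [iQ|/ltnW Qi] := leqP i Q.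
  rewrite (le_trans _ hQ)// (le_trans _ (nd_h i Q x iQ))//.
  by rewrite ler_piMl//; have /andP[] := h01 i x.
rewrite (le_trans _ Qc)// -[leRHS]mulr1 ler_pM//; try by have /andP[] := h01 i x.
by rewrite ler_wiXn2l// ?invr_ge0// invf_le1// ler1n.
Qed.

(** [dini] is applied to the infima of [P^n phi] over [n >= i]: they increase with [i], are
    continuous by equicontinuity, and become positive at each point by recurrence. *)
Lemma uniform_recurrence r k : 0 < r -> 0 < k -> exists N (c : R) l,
  [/\ 0 < c <= 1, bcont l, forall x, 0 <= l x <= 1,
    forall x, nexp P N (tent z r) x <= c -> l x = 1 & forall m, nexp P m l z <= k].
Proof.
move=> r0 k0; pose phi := tent z r.
have bphi : bcont phi := bcont_tent _ _.
have bm : @bmeas _ (borel X) R phi by exact: bcont_bmeas.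
pose a i x j := nexp P (i + j) phi x.
have a01 i x : unit_valued (a i x).
  move=> j; rewrite nexp_ge_cst ?nexp_le_cst// => y; [exact: tent_le1|exact: tent_ge0].
pose h i x := inf (range (a i x)).
have ch i : continuous (h i).
  apply/continuous_epsP => x e e0; have [d d0 dP] := equicP bphi x e0.
  by exists d => // y xy; apply: inf_dist => // j; exact: dP.
have h01 i x : 0 <= h i x <= 1.
  apply/andP; split; last first.
    by rewrite (le_trans (inf_le 0%N (a01 i x)))//; have /andP[] := a01 i x 0%N.
  by apply: lb_le_inf; [exists (a i x 0%N), 0%N|move=> _ [j _ <-]; have /andP[] := a01 i x j].
have nd_h i j x : (i <= j)%N -> h i x <= h j x.
  move=> ij; apply: lb_le_inf; first by exists (a j x 0%N), 0%N.
  move=> _ [l _ <-]; have := inf_le (j - i + l)%N (a01 i x).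
  by rewrite /a addnA subnKC.
have h_gt0 x : exists i, 0 < h i x.
  have [b b0 [N bN]] := recurrent x r0; exists N; apply: (lt_le_trans b0).
  apply: lb_le_inf; first by exists (a N x 0%N), 0%N.
  by move=> _ [j _ <-]; apply: bN; exact: leq_addr.
have [Q [c [l [c0 bl l01 lP lk]]]] := dini ch h01 nd_h h_gt0 k0.
(* Capping at 1 keeps [1 - beta] non-negative in the coupling. *)
exists Q, (Num.min c 1), l; split => //; first by rewrite lt_min c0 ltr01/= ge_min lexx orbT.
move=> x xc; apply: lP; apply: (le_trans (inf_le 0%N (a01 Q x))).
by rewrite /a addn0 (le_trans xc)// ge_min lexx.
Qed.

End dini.

(** * Asymptotic coupling *)

Section coupling.
Context {R : realType} {X : completeMetricType R}.
Variables (P : R.-pker (borel X) ~> (borel X)) (z : X).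
Local Open Scope ring_scope.
Implicit Types (L : (X -> R) -> R) (f g h : X -> R).
Local Notation meas f := (@bmeas _ (borel X) R f).

(* [L] plays the role of integration against a measure of mass [t] lying below
   the law of the chain started at [z] at some time. *)
Definition subfunctional L t := exists i,
  [/\ forall f g, meas f -> meas g -> L (fun x => f x + g x) = L f + L g,
    forall c f, meas f -> L (fun x => c * f x) = c * L f,
    forall h, meas h -> (forall x, 0 <= h x) -> 0 <= L h <= nexp P i h z &
    L (fun=> 1) = t].

Section subfunctional_theory.
Variables (L : (X -> R) -> R) (t : R).
Hypothesis Lt : subfunctional L t.

Lemma subfunctionalD f g : meas f -> meas g -> L (fun x => f x + g x) = L f + L g.
Proof. by case: Lt => i [LD _ _ _]; exact: LD. Qed.

Lemma subfunctionalZ c f : meas f -> L (fun x => c * f x) = c * L f.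
Proof. by case: Lt => i [_ LZ _ _]; exact: LZ. Qed.

Lemma subfunctional1 : L (fun=> 1) = t.
Proof. by case: Lt => i []. Qed.

Lemma subfunctionalB f g : meas f -> meas g -> L (fun x => f x - g x) = L f - L g.
Proof.
move=> mf mg; rewrite -(mulN1r (L g)) -subfunctionalZ// -subfunctionalD//; last exact: bmeasZ.
by congr L; apply/funext => x; rewrite mulN1r.
Qed.

Lemma subfunctional_le f g : meas f -> meas g -> (forall x, f x <= g x) -> L f <= L g.
Proof.
move=> mf mg fg; rewrite -subr_ge0 -subfunctionalB//.
have gf x : 0 <= g x - f x by rewrite subr_ge0.
by case: Lt => i [_ _ L0 _]; have /andP[] := L0 _ (bmeasB mg mf) gf.
Qed.

Lemma subfunctional_cst c : L (fun=> c) = c * t.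
Proof.
rewrite -subfunctional1 -subfunctionalZ; last exact: bmeas_cst.
by congr L; apply/funext => x; rewrite mulr1.
Qed.

Lemma subfunctional_norm_le f M : meas f -> (forall x, `|f x| <= M) -> `|L f| <= M * t.
Proof.
move=> mf fM; rewrite ler_norml -mulNr -!subfunctional_cst; apply/andP; split.
  apply: subfunctional_le => //; first exact: bmeas_cst.
  by move=> x; have := fM x; rewrite ler_norml => /andP[].
apply: subfunctional_le => //; first exact: bmeas_cst.
by move=> x; have := fM x; rewrite ler_norml => /andP[].
Qed.

Lemma subfunctional_mass : 0 <= t <= 1.
Proof.
case: Lt => i [_ _ L0 <-].
by have := L0 _ (bmeas_cst 1) (fun=> ler01); rewrite nexp_cst.
Qed.

End subfunctional_theory.

Section coupling_step.
Variables (f phi l : X -> R) (M e k beta : R) (N : nat).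
Hypotheses (mf : meas f) (fM : forall x, `|f x| <= M).
Hypotheses (mphi : meas phi) (phi01 : forall x, 0 <= phi x <= 1).
Hypotheses (ml : meas l) (l01 : forall x, 0 <= l x <= 1).
Hypothesis phi_close : forall n y, phi y * `|nexp P n f y - nexp P n f z| <= e * phi y.
Hypotheses (e0 : 0 <= e) (beta01 : 0 < beta <= 1).
Hypothesis phi_beta : forall x, nexp P N phi x <= beta -> l x = 1.
Hypothesis l_small : forall m, nexp P m l z <= k.

(* A fraction [beta * (t - k)] of the mass reaches the support of [phi] at time [N]
   and evolves from then on nearly as if started at [z]; [L'] is what remains.  As
   [L'] is still below the law of the chain, the step can be iterated. *)
Lemma subfunctional_capture L t : subfunctional L t -> k < t ->
  exists2 L', subfunctional L' (t - beta * (t - k)) &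
  forall n, `|L (nexp P (N + n) f) - L' (nexp P n f) - beta * (t - k) * nexp P n f z|
    <= e * (beta * (t - k)).
Proof.
move=> Lt kt; have /andP[b0 b1] := beta01.
set c := beta * (t - k).
have c0 : 0 < c by rewrite mulr_gt0// subr_gt0.
have mN h : meas h -> meas (nexp P N h) by exact: bmeas_nexp.
have mNphi := mN _ mphi.
(* By [phi_beta], [nexp P N phi >= beta * (1 - l)]; and [L l <= k], as [L] lies below a law started
   at [z]. *)
have cL : c <= L (nexp P N phi).
  have mlow : meas (fun x => beta - beta * l x) by apply: bmeasB; [exact: bmeas_cst|exact: bmeasZ].
  apply: (@le_trans _ _ (L (fun x => beta - beta * l x))).
    rewrite (subfunctionalB Lt)//; [|exact: bmeas_cst|exact: bmeasZ].
    rewrite (subfunctional_cst Lt) (subfunctionalZ Lt)// -mulrBr ler_wpM2l ?(ltW b0)//.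
    rewrite lerD2l lerN2; case: Lt => i [_ _ L0 _].
    have /andP[_] := L0 l ml (fun x => (andP (l01 x)).1).
    by move/le_trans; apply; exact: l_small.
  apply: (subfunctional_le Lt) => // x.
  have [/phi_beta ->|/ltW] := leP (nexp P N phi x) beta.
    rewrite mulr1 subrr; apply: nexp_ge_cst => // y; by have /andP[] := phi01 y.
  by apply: le_trans; rewrite lerBlDr lerDl mulr_ge0 ?(ltW b0)//; have /andP[] := l01 x.
have Lphi0 : 0 < L (nexp P N phi) := lt_le_trans c0 cL.
(* Scaling by [theta] makes the captured mass exactly [c], which depends on [L] only through [t]:
   two functionals of equal mass leave remainders of equal mass. *)
pose theta := c / L (nexp P N phi).
have th0 : 0 <= theta by rewrite divr_ge0 ?(ltW c0) ?(ltW Lphi0).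
have th1 : theta <= 1 by rewrite ler_pdivrMr// mul1r.
have thc : theta * L (nexp P N phi) = c by rewrite divfK// gt_eqF.
pose L' h := L (nexp P N (fun x => h x - theta * (phi x * h x))).
have mcap h : meas h -> meas (fun x => theta * (phi x * h x)) by move=> mh; apply/bmeasZ/bmeasM.
have mres h : meas h -> meas (fun x => h x - theta * (phi x * h x)).
  by move=> mh; apply: bmeasB => //; exact: mcap.
have split_L' h : meas h -> L (nexp P N h) - L' h = theta * L (nexp P N (fun x => phi x * h x)).
  move=> mh; have mph : meas (fun x => phi x * h x) by exact: bmeasM.
  have mrh := mres _ mh; have mNh := mN _ mh; have mNrh := mN _ mrh; have mNph := mN _ mph.
  rewrite /L' -(subfunctionalB Lt)// -(subfunctionalZ Lt)//.
  congr L; apply/funext => x; rewrite -nexpB// -nexpZ//.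
  by congr nexp; apply/funext => y; rewrite opprB addrC subrK.
exists L'.
  case: (Lt) => i [LD LZ L0 L1]; exists (i + N)%N; split.
  - move=> g h mg mh; have mrg := mres _ mg; have mrh := mres _ mh.
    have mNg := mN _ mrg; have mNh := mN _ mrh.
    rewrite /L' -(subfunctionalD Lt)//; congr L.
    apply/funext => x; rewrite -nexpDl//; congr nexp; apply/funext => y.
    by rewrite !mulrDr opprD addrACA.
  - move=> a h mh; have mrh := mres _ mh; have mNh := mN _ mrh.
    rewrite /L' -(subfunctionalZ Lt)//; congr L.
    apply/funext => x; rewrite -nexpZ//; congr nexp; apply/funext => y.
    by rewrite /=; ring.
  - move=> h mh h0.
    have res_ge0 x : 0 <= h x - theta * (phi x * h x).
      have /andP[p0 p1] := phi01 x.
      by rewrite mulrA subr_ge0 ler_piMl// mulr_ile1.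
    have res_le x : h x - theta * (phi x * h x) <= h x.
      have /andP[p0 p1] := phi01 x.
      by rewrite lerBlDr lerDl; apply: mulr_ge0 => //; exact: mulr_ge0.
    have Nres0 x : 0 <= nexp P N (fun x => h x - theta * (phi x * h x)) x.
      by apply: nexp_ge_cst => //; exact: mres.
    have /andP[-> Lle] := L0 _ (mN _ (mres _ mh)) Nres0 => /=.
    rewrite (le_trans Lle)// nexpD//; apply: nexp_le; [exact/mN/mres|exact: mN|].
    by move=> x; apply: nexp_le => //; exact: mres.
  - have := split_L' _ (bmeas_cst 1); rewrite (_ : nexp P N (fun=> 1) = fun=> 1); last first.
      by apply/funext => x; rewrite nexp_cst.
    rewrite L1 (_ : (fun x => phi x * 1) = phi); last by apply/funext => x; rewrite mulr1.
    by rewrite thc => <-; rewrite opprB addrC subrK.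
move=> n; rewrite nexpD// split_L'; last exact: bmeas_nexp.
rewrite -thc.
have mnf : meas (nexp P n f) by exact: bmeas_nexp.
have mpn : meas (fun x => phi x * nexp P n f x) by exact: bmeasM.
have mp1 : meas (fun x => nexp P n f z * phi x) by exact: bmeasZ.
have -> : theta * L (nexp P N (fun x => phi x * nexp P n f x)) -
    theta * L (nexp P N phi) * nexp P n f z =
    theta * L (nexp P N (fun x => phi x * nexp P n f x - nexp P n f z * phi x)).
  rewrite -mulrA -mulrBr; congr (_ * _).
  have mNpn := mN _ mpn; have mzN := bmeasZ (nexp P n f z) mNphi.
  rewrite mulrC -(subfunctionalZ Lt)// -(subfunctionalB Lt)//.
  by congr L; apply/funext => x; rewrite nexpB// nexpZ.
rewrite normrM ger0_norm// mulrCA ler_wpM2l//.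
rewrite -(subfunctionalZ Lt)//.
have meph : meas (fun x => e * phi x) by exact: bmeasZ.
have mdiff : meas (fun x => phi x * nexp P n f x - nexp P n f z * phi x) by exact: bmeasB.
have -> : (fun x => e * nexp P N phi x) = nexp P N (fun x => e * phi x).
  by apply/funext => x; rewrite nexpZ.
have pt x : `|phi x * nexp P n f x - nexp P n f z * phi x| <= e * phi x.
  rewrite (mulrC _ (phi x)) -mulrBr normrM ger0_norm; first exact: phi_close.
  by have /andP[] := phi01 x.
rewrite ler_norml; apply/andP; split.
  rewrite -mulN1r -(subfunctionalZ Lt); last exact: mN.
  apply: (subfunctional_le Lt); [exact/bmeasZ/mN|exact: mN|move=> x].
  rewrite -nexpZ//; apply: nexp_le => //; first exact: bmeasZ.
  by move=> y; have := pt y; rewrite ler_norml mulN1r => /andP[].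
apply: (subfunctional_le Lt); [exact: mN|exact: mN|move=> x].
by apply: nexp_le => // y; have := pt y; rewrite ler_norml => /andP[].
Qed.

(** Captured parts of equal mass are both compared with the chain started at [z], at a cost of
    [2 * e] per unit of mass. Each round multiplies [t - k] by [1 - beta]; what is never captured is
    estimated by [2 * M] times its mass, and the rounds stop being useful once the mass is at most
    [k]. *)
Lemma coupling_bound m L L' t : subfunctional L t -> subfunctional L' t -> forall n,
  `|L (nexp P (m * N + n) f) - L' (nexp P (m * N + n) f)| <=
  2 * e * t + 2 * M * ((1 - beta) ^+ m * Num.max 0 (t - k) + k).
Proof.
have M0 : 0 <= M := le_trans (normr_ge0 _) (fM z).
have mnf n : meas (nexp P n f) by exact: bmeas_nexp.
have /andP[b0 b1] := beta01.
have trivial_bound L1 L2 s n : subfunctional L1 s -> subfunctional L2 s ->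
    `|L1 (nexp P n f) - L2 (nexp P n f)| <= 2 * M * s.
  move=> L1s L2s; rewrite (le_trans (ler_normB _ _))//.
  have nf x : `|nexp P n f x| <= M by exact: nexp_norm_le.
  have := subfunctional_norm_le L1s (mnf n) nf.
  have := subfunctional_norm_le L2s (mnf n) nf; lra.
elim: m L L' t => [|m ih] L L' t Lt L't n.
  rewrite mul0n add0n expr0 mul1r (le_trans (trivial_bound _ _ _ n Lt L't))//.
  rewrite (@le_trans _ _ (2 * M * (Num.max 0 (t - k) + k)))//.
    by rewrite ler_wpM2l ?mulr_ge0// -lerBlDr le_max lexx orbT.
  by rewrite lerDr !mulr_ge0//; have /andP[] := subfunctional_mass Lt.
have t0 : 0 <= t by have /andP[] := subfunctional_mass Lt.
have [tk|kt] := leP t k.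
  rewrite (le_trans (trivial_bound _ _ _ _ Lt L't))// max_l ?subr_le0// mulr0 add0r.
  rewrite (@le_trans _ _ (2 * M * k))//; first by rewrite ler_wpM2l ?mulr_ge0.
  by rewrite lerDr !mulr_ge0.
have [L1 L1s L1n] := subfunctional_capture Lt kt.
have [L2 L2s L2n] := subfunctional_capture L't kt.
rewrite mulSn -addnA; set j := (m * N + n)%N.
have := ih _ _ _ L1s L2s n; rewrite -/j.
have -> : t - beta * (t - k) - k = (1 - beta) * (t - k) by ring.
have := L1n j; have := L2n j.
have tk0 : 0 <= (1 - beta) * (t - k) by rewrite mulr_ge0 ?subr_ge0// ltW.
rewrite (max_r tk0) max_r ?subr_ge0 ?(ltW kt)// exprSr.
set p := (1 - beta) ^+ m.
by rewrite !ler_norml => /andP[? ?] /andP[? ?] /andP[? ?]; apply/andP; split; lra.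
Qed.

End coupling_step.

Hypothesis equicP : forall f, bcont f -> equicont P f.
Hypothesis recurrent : forall (r : R) (x : X), 0 < r -> exists2 a : R, 0 < a &
  exists N, forall n, (N <= n)%N -> a <= nexp P n (tent z r) x.

(** [n0] depends on neither functional, so the pieces may come from laws at arbitrarily late times.
    The constants give [2 * (e / 8)] for the captured mass and [4 * M * (e / (8 * M)) = e / 2] for
    the rest. *)
Lemma coupling f e : bcont f -> 0 < e -> exists n0, forall L L' t,
  subfunctional L t -> subfunctional L' t -> forall n, (n0 <= n)%N ->
  `|L (nexp P n f) - L' (nexp P n f)| <= e.
Proof.
move=> bf e0; have [_ [M0 fM0]] := bf.
pose M := `|M0| + 1; have M_gt0 : 0 < M by rewrite ltr_pwDr.
have fM y : `|f y| <= M by rewrite (le_trans (fM0 y))// ler_wpDr// ler_norm.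
have e8 : 0 < e / 8 by rewrite divr_gt0.
have [d d0 fd] := equicP bf z e8.
have phi_close n y : tent z d y * `|nexp P n f y - nexp P n f z| <= e / 8 * tent z d y.
  have [zy|zy] := pselect (ball z d y); last by rewrite tent_eq0// mul0r mulr0.
  by rewrite mulrC ler_wpM2r ?tent_ge0// fd.
have k0 : 0 < e / (8 * M) by rewrite divr_gt0 ?mulr_gt0.
have [N [beta [l [beta01 bl l01 lb lk]]]] := uniform_recurrence equicP recurrent d0 k0.
have /andP[b0 b1] := beta01.
have : ((1 - beta) ^+ i : R) @[i --> \oo] --> 0.
  by apply: cvg_expr; rewrite ger0_norm ?subr_ge0// ltrBlDr ltrDl.
move=> /cvgrPdist_le/(_ _ k0)[m _ /(_ m (leqnn _))].
rewrite sub0r normrN ger0_norm ?exprn_ge0 ?subr_ge0// => mk.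
exists (m * N)%N => L L' t Lt L't n mn; rewrite -(subnKC mn).
have phi01 x : 0 <= tent z d x <= 1 by rewrite tent_ge0 tent_le1.
have := coupling_bound (bcont_bmeas bf) fM (bcont_bmeas (bcont_tent z d)) phi01
  (bcont_bmeas bl) l01 phi_close (ltW e8) beta01 lb lk m Lt L't (n - m * N).
move/le_trans; apply; have /andP[t0 t1] := subfunctional_mass Lt.
have max1 : Num.max 0 (t - e / (8 * M)) <= 1.
  by rewrite ge_max ler01/= (le_trans _ t1)// lerBlDr lerDl ltW.
have et : e / 8 * t <= e / 8 by rewrite ler_piMr// ltW.
have Mk : M * (e / (8 * M)) = e / 8 by field; rewrite gt_eqF.
have : M * ((1 - beta) ^+ m * Num.max 0 (t - e / (8 * M))) <= M * (e / (8 * M)).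
  rewrite ler_wpM2l ?(ltW M_gt0)// (le_trans _ mk)// ler_piMr// exprn_ge0//.
  by rewrite subr_ge0.
lra.
Qed.

End coupling.

(** * Measures from positive functionals *)

Section distance_to_complement.
Context {R : realType} {X : completeMetricType R}.
Local Open Scope ring_scope.
Variable U : set X.

(** The element 1 truncates the distance to the complement and keeps the set non-empty when [U] is
    the whole space. *)
Let gaps x := [set 1 : R] `|` [set mdist x y | y in ~` U].

Definition depth x : R := inf (gaps x).

Let gaps_ge0 x : lbound (gaps x) 0.
Proof. by move=> _ [->|[y _ <-]]; [exact: ler01|exact: mdist_ge0]. Qed.

Let gaps_has_inf x : has_inf (gaps x).
Proof. by split; [exists 1; left|exists 0; exact: gaps_ge0]. Qed.

Lemma depth_ge0 x : 0 <= depth x.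
Proof. by apply: lb_le_inf; [exists 1; left|exact: gaps_ge0]. Qed.

Lemma depth_eq0 x : ~ U x -> depth x = 0.
Proof.
move=> Ux; apply/eqP; rewrite eq_le depth_ge0 andbT.
by apply: ge_inf; [case: (gaps_has_inf x)|right; exists x => //; exact: mdistxx].
Qed.

Lemma depth_gt0 x : open U -> U x -> 0 < depth x.
Proof.
move=> oU Ux; have /nbhs_ballP[d /= d0 dU] := open_nbhs_nbhs (conj oU Ux).
have : 0 < Num.min d 1 by rewrite lt_min d0 ltr01.
move/lt_le_trans; apply; apply: lb_le_inf; first by exists 1; left.
move=> _ [->|[y Uy <-]]; first by rewrite ge_min lexx orbT.
rewrite ge_min leNgt; apply/orP; left; apply/negP => xy.
by apply: Uy; apply: dU; rewrite ballEmdist.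
Qed.

Lemma continuous_depth : continuous depth.
Proof.
have lip x y : depth x - mdist x y <= depth y.
  apply: lb_le_inf; first by exists 1; left.
  have inf_le1 t : gaps x t -> depth x <= t.
    by move=> xt; apply: ge_inf => //; case: (gaps_has_inf x).
  move=> _ [->|[v Uv <-]].
    by rewrite lerBlDr (le_trans (inf_le1 1 _))//; [left|rewrite lerDl mdist_ge0].
  rewrite lerBlDr addrC; apply: le_trans (metric_triangle x y v).
  by apply: inf_le1; right; exists v.
apply/continuous_epsP => x e e0; exists e => // y; rewrite ballEmdist/= => xy.
have := lip x y; have := lip y x; rewrite (metric_sym y x) => ? ?.
by rewrite ler_norml; apply/andP; split; lra.
Qed.

Definition inner (n : nat) x := clamp (n%:R * depth x).

Lemma bcont_inner n : bcont (inner n).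
Proof. by apply: bcont_clamp => x; apply: cvgMl_tmp; exact: continuous_depth. Qed.

Lemma inner_eq0 n x : ~ U x -> inner n x = 0.
Proof. by move=> Ux; rewrite /inner depth_eq0// mulr0 clamp_eq0. Qed.

Lemma inner_eq1 x : open U -> U x -> exists N, forall n, (N <= n)%N -> inner n x = 1.
Proof.
move=> oU Ux; have d0 := depth_gt0 oU Ux; exists (Num.truncn (depth x)^-1).+1 => n Nn.
apply: clamp_eq1; rewrite -ler_pdivrMr// mul1r ltW// (lt_le_trans (truncnS_gt _))//.
by rewrite ler_nat.
Qed.

Lemma inner_le n m x : (n <= m)%N -> inner n x <= inner m x.
Proof. by move=> nm; apply: clamp_le; rewrite ler_wpM2r ?depth_ge0// ler_nat. Qed.

End distance_to_complement.

Section daniell.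
Context {R : realType} {X : completeMetricType R}.
Local Open Scope ring_scope.
Variable Lam : (X -> R) -> R.
Hypothesis LamD : forall f g, bcont f -> bcont g -> Lam (fun x => f x + g x) = Lam f + Lam g.
Hypothesis LamZ : forall c f, bcont f -> Lam (fun x => c * f x) = c * Lam f.
Hypothesis Lam_ge0 : forall f, bcont f -> (forall x, 0 <= f x) -> 0 <= Lam f.
Hypothesis Lam1 : Lam (fun=> 1) = 1.
(** Daniell's continuity condition, for increasing sequences that reach 1 at every point: this is
    what clamping a cover of the space produces. *)
Hypothesis Lam_dini : forall h : nat -> X -> R, (forall n, bcont (h n)) ->
  (forall n x, 0 <= h n x <= 1) -> (forall n m x, (n <= m)%N -> h n x <= h m x) ->
  (forall x, exists n, h n x = 1) -> forall e, 0 < e -> exists n, 1 - e <= Lam (h n).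

Lemma LamB f g : bcont f -> bcont g -> Lam (fun x => f x - g x) = Lam f - Lam g.
Proof.
move=> bf bg; rewrite -(mulN1r (Lam g)) -LamZ// -LamD//; last exact: bcontZ.
by congr Lam; apply/funext => x; rewrite mulN1r.
Qed.

Lemma Lam_le f g : bcont f -> bcont g -> (forall x, f x <= g x) -> Lam f <= Lam g.
Proof.
move=> bf bg fg; rewrite -subr_ge0 -LamB//; apply: Lam_ge0; first exact: bcontB.
by move=> x; rewrite subr_ge0.
Qed.

Lemma Lam_cst c : Lam (fun=> c) = c.
Proof.
rewrite -[RHS]mulr1 -Lam1 -LamZ; last exact: bcont_cst.
by congr Lam; apply/funext => x; rewrite mulr1.
Qed.

Lemma bcont_sum (f : nat -> X -> R) n : (forall i, bcont (f i)) ->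
  bcont (fun x => \sum_(i < n) f i x).
Proof.
move=> bf; elim: n => [|n ih].
  by rewrite (_ : (fun x => _) = fun=> 0); [exact: bcont_cst|apply/funext => x; rewrite big_ord0].
rewrite (_ : (fun x => _) = fun x => \sum_(i < n) f i x + f n x); first exact: bcontD.
by apply/funext => x; rewrite big_ord_recr.
Qed.

Lemma Lam_sum (f : nat -> X -> R) n : (forall i, bcont (f i)) ->
  Lam (fun x => \sum_(i < n) f i x) = \sum_(i < n) Lam (f i).
Proof.
move=> bf; elim: n => [|n ih].
  by rewrite big_ord0 -[RHS](Lam_cst 0); congr Lam; apply/funext => x; rewrite big_ord0.
rewrite big_ord_recr/= -ih -LamD//; last exact: bcont_sum.
by congr Lam; apply/funext => x; rewrite big_ord_recr.
Qed.

(* The sequence [g] stands for the partial sums of a countable cover by functions,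
   and the bound on all the [Lam (g n)] for the sum of the corresponding series. *)
Definition cover_cost (A : set X) (c : R) := exists g : nat -> X -> R,
  [/\ forall n, bcont (g n), forall n x, 0 <= g n x,
    forall n m x, (n <= m)%N -> g n x <= g m x,
    forall n, Lam (g n) <= c & forall x, A x -> exists n, 1 <= g n x].

Lemma cover_cost_fun A f : bcont f -> (forall x, 0 <= f x) -> (forall x, A x -> 1 <= f x) ->
  cover_cost A (Lam f).
Proof. by move=> bf f0 f1; exists (fun=> f); split => // x /f1; exists 0%N. Qed.

Lemma cover_cost_ge0 A : lbound (cover_cost A) 0.
Proof. by move=> c [g [bg g0 _ gc _]]; exact: le_trans (Lam_ge0 (bg 0%N) (g0 0%N)) (gc 0%N). Qed.

Lemma cover_cost_has_inf A : has_inf (cover_cost A).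
Proof.
split; last by exists 0; exact: cover_cost_ge0.
by exists (Lam (fun=> 1)); apply: cover_cost_fun => //; exact: bcont_cst.
Qed.

Lemma inf_cover_le A c : cover_cost A c -> inf (cover_cost A) <= c.
Proof. by apply: ge_inf; case: (cover_cost_has_inf A). Qed.

Definition outer (A : set X) : \bar R := (inf (cover_cost A))%:E.

Let outer0 : outer set0 = 0%E.
Proof.
congr EFin; apply/eqP; rewrite eq_le; apply/andP; split.
  rewrite -(Lam_cst 0); apply: inf_cover_le; apply: cover_cost_fun => //.
  exact: bcont_cst.
by apply: lb_le_inf; [case: (cover_cost_has_inf set0)|exact: cover_cost_ge0].
Qed.

Let outer_ge0 A : (0 <= outer A)%E.
Proof.
by rewrite lee_fin; apply: lb_le_inf; [case: (cover_cost_has_inf A)|exact: cover_cost_ge0].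
Qed.

Let le_outer : {homo outer : A B / A `<=` B >-> (A <= B)%E}.
Proof.
move=> A B AB; rewrite lee_fin; apply: lb_le_inf; first by case: (cover_cost_has_inf B).
by move=> c [g [? ? ? ? gB]]; apply: inf_cover_le; exists g; split => // x /AB; exact: gB.
Qed.

Let outer_sigma_subadditive : sigma_subadditive outer.
Proof.
move=> F; apply/lee_addgt0Pr => e e0.
have [Soo|] := eqVneq (\sum_(i <oo) outer (F i))%E +oo%E; first by rewrite Soo/= leey.
rewrite -ltey => Sfin.
have S0 : (0 <= \sum_(i <oo) outer (F i))%E by apply: nneseries_ge0 => i _ _; exact: outer_ge0.
have /fineK Sr : (\sum_(i <oo) outer (F i))%E \is a fin_num by rewrite ge0_fin_numE.
set r := fine _ in Sr.
have coverP j : exists g c, [/\ cover_cost (F j) c, c <= inf (cover_cost (F j)) + e / 2 ^+ j.+1 &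
  [/\ forall n, bcont (g n), forall n x, 0 <= g n x,
    forall n m x, (n <= m)%N -> g n x <= g m x,
    forall n, Lam (g n) <= c & forall x, F j x -> exists n : nat, 1 <= g n x]].
  have ej : 0 < e / 2 ^+ j.+1 by rewrite divr_gt0// exprn_gt0.
  have [c Fc cle] := inf_adherent ej (cover_cost_has_inf (F j)).
  by have [g gP] := Fc; exists g, c; split => //; exact: ltW.
have /choice[g /choice[c gP]] := coverP.
rewrite -Sr -EFinD lee_fin; apply: inf_cover_le.
(* Diagonal sum: stage [n] adds stage [n] of the covers of index below [n], so it increases both
   with the stages and with the number of covers. Cover [j] takes part from stage [j.+1] on. *)
exists (fun n x => \sum_(j < n) g j n x); split.
- move=> n. apply: (@bcont_sum (fun j => g j n)) => j.
  by have [_ _ [bg _ _ _ _]] := gP j.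
- by move=> n x; apply: sumr_ge0 => j _; have [_ _ [_ g0 _ _ _]] := gP j.
- move=> n m x nm; rewrite (big_ord_widen m (fun j => g j n x))//.
  rewrite big_mkcond/=; apply: ler_sum => j _.
  have [_ _ [_ g0 nd _ _]] := gP j.
  by case: ifP => _; [exact: nd|exact: g0].
- move=> n; rewrite (@Lam_sum (fun j => g j n)); last first.
    by move=> j; have [_ _ [bg _ _ _ _]] := gP j.
  rewrite (@le_trans _ _ (\sum_(j < n) (inf (cover_cost (F j)) + e / 2 ^+ j.+1)))//.
    apply: ler_sum => j _; have [_ cle [_ _ _ Lc _]] := gP j.
    exact: le_trans (Lc n) cle.
  rewrite big_split/= lerD//.
    rewrite -lee_fin Sr -sumEFin -(big_mkord xpredT (fun j => (inf (cover_cost (F j)))%:E)).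
    by apply: nneseries_lim_ge => i _ _; exact: outer_ge0.
  have -> : \sum_(j < n) e / 2 ^+ j.+1 = e * (1 - 2^-1 ^+ n).
    elim: n => [|n ih]; first by rewrite big_ord0 expr0 subrr mulr0.
    rewrite big_ord_recr ih/= -exprVn exprSr; lra.
  by rewrite ler_piMr ?(ltW e0)// lerBlDr lerDl exprn_ge0.
- move=> x [j _ Fjx]; have [_ _ [_ g0 nd _ /(_ x Fjx)[n gn]]] := gP j.
  exists (maxn n j.+1); rewrite (le_trans gn)// (le_trans (nd _ _ x (leq_maxl n j.+1)))//.
  have jn : (j < maxn n j.+1)%N by rewrite leq_max leqnn orbT.
  rewrite (bigD1 (Ordinal jn))//= lerDl; apply: sumr_ge0 => i _.
  by have [_ _ [_ gi0 _ _ _]] := gP i.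
Qed.

HB.instance Definition _ := isOuterMeasure.Build R X outer
  outer0 outer_ge0 le_outer outer_sigma_subadditive.

(* A cover [g] of [A] is split into [g n * u n], which covers [A `&` U] as [u n]
   increases to the indicator of [U], and [g n * (1 - u m)], which covers the rest
   of [A]; for [m] large the costs add up to at most the cost of [g], plus [e]. *)
Lemma open_caratheodory (U : set X) : open U -> outer.-caratheodory U.
Proof.
move=> oU; apply: le_caratheodory_measurable => A.
apply/lee_addgt0Pr => e e0; rewrite -!EFinD lee_fin -lerBlDr.
apply: lb_le_inf; first by case: (cover_cost_has_inf A).
move=> c [g [bg g0 nd gc gA]]; rewrite lerBlDr.
pose u := inner U.
have u01 n x : 0 <= u n x <= 1 by rewrite clamp_ge0 clamp_le1.
have bgu n m : bcont (fun x => g n x * u m x) by apply: bcontM => //; exact: bcont_inner.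
have ndgu n n' m m' x : (n <= n')%N -> (m <= m')%N -> g n x * u m x <= g n' x * u m' x.
  move=> nn mm; apply: ler_pM => //; [by have /andP[] := u01 m x|exact: nd|exact: inner_le].
pose S := range (fun n => Lam (fun x => g n x * u n x)).
have guc n : Lam (fun x => g n x * u n x) <= c.
  apply: le_trans (gc n); apply: Lam_le => // x.
  by rewrite ler_piMr//; have /andP[] := u01 n x.
have supS : has_sup S.
  by split; [exists (Lam (fun x => g 0%N x * u 0%N x)), 0%N|exists c => _ [n _ <-]].
have [_ [m _ <-] mS] := sup_adherent e0 supS.
have AU : cover_cost (A `&` U) (sup S).
  exists (fun n x => g n x * u n x); split => //.
  - by move=> n x; rewrite mulr_ge0//; have /andP[] := u01 n x.
  - by move=> n n' x nn; exact: ndgu.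
  - by move=> n; apply: ub_le_sup; [case: supS|exists n].
  - move=> x [/gA[n gn] Ux]; have [N uN] := inner_eq1 oU Ux.
    exists (maxn n N); rewrite /u uN ?leq_maxr// mulr1 (le_trans gn)//.
    by apply: nd; exact: leq_maxl.
have AC : cover_cost (A `&` ~` U) (c - sup S + e).
  exists (fun n x => g n x - g n x * u m x).
  have bgm n : bcont (fun x => g n x - g n x * u m x) by exact: bcontB.
  have ndm n n' x : (n <= n')%N -> g n x - g n x * u m x <= g n' x - g n' x * u m x.
    move=> nn; rewrite -{1}(mulr1 (g n x)) -{1}(mulr1 (g n' x)) -!mulrBr.
    rewrite ler_wpM2r//; last exact: nd.
    by rewrite subr_ge0; have /andP[] := u01 m x.
  split => //.
  - by move=> n x; rewrite subr_ge0 ler_piMr//; have /andP[] := u01 m x.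
  - move=> n; apply: (@le_trans _ _ (Lam (fun x => g (maxn n m) x - g (maxn n m) x * u m x))).
      by apply: Lam_le => // x; apply: ndm; exact: leq_maxl.
    rewrite LamB//; have := gc (maxn n m).
    have : Lam (fun x => g m x * u m x) <= Lam (fun x => g (maxn n m) x * u m x).
      by apply: Lam_le => // x; apply: ndgu => //; exact: leq_maxr.
    move: mS; lra.
  - move=> x [/gA[n gn] Ux]; exists n.
    by rewrite /u inner_eq0// mulr0 subr0.
have := inf_cover_le AU; have := inf_cover_le AC; lra.
Qed.

Definition riesz (A : set (borel X)) : \bar R := outer A.

Let borel_caratheodory (A : set (borel X)) : measurable A -> outer.-caratheodory A.
Proof.
apply: smallest_sub; last by move=> U; exact: open_caratheodory.
split; first exact: caratheodory_measurable_set0.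
- by move=> B; rewrite setTD; exact: caratheodory_measurable_setC.
- by move=> F; exact: caratheodory_measurable_bigcup.
Qed.

Let riesz0 : riesz set0 = 0%E. Proof. exact: outer0. Qed.

Let riesz_ge0 A : (0 <= riesz A)%E. Proof. exact: outer_ge0. Qed.

Let riesz_sigma_additive : semi_sigma_additive riesz.
Proof.
move=> F mF tF mUF; apply: (@caratheodory_measure_sigma_additive R X outer) => //.
- by move=> i; exact: borel_caratheodory.
- exact: borel_caratheodory.
Qed.

HB.instance Definition _ := isMeasure.Build _ (borel X) R riesz
  riesz0 riesz_ge0 riesz_sigma_additive.

(** The constant 1 covers the space at cost 1. Conversely any cover, clamped, reaches 1 everywhere,
    and [Lam_dini] shows that its cost is at least [1 - e]. *)
Let riesz_setT : riesz setT = 1%E.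
Proof.
congr EFin; apply/eqP; rewrite eq_le; apply/andP; split.
  by rewrite -Lam1; apply: inf_cover_le; apply: cover_cost_fun => //; exact: bcont_cst.
apply: lb_le_inf; first by case: (cover_cost_has_inf setT).
move=> c [g [bg g0 nd gc gT]]; apply/ler_addgt0Pr => e e0.
pose h n x := clamp (g n x).
have bh n : bcont (h n) by apply: bcont_clamp; case: (bg n).
have [n hn] : exists n, 1 - e <= Lam (h n).
  apply: Lam_dini => //.
  - by move=> n x; rewrite clamp_ge0 clamp_le1.
  - by move=> n m x nm; apply: clamp_le; exact: nd.
  - by move=> x; have [n gn] := gT x I; exists n; exact: clamp_eq1.
rewrite -lerBlDr (le_trans hn)// (le_trans _ (gc n))//; apply: Lam_le => // x.
by rewrite /h /clamp ge_max g0 ge_min lexx orbT.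
Qed.

HB.instance Definition _ := Measure_isProbability.Build _ _ _ riesz riesz_setT.

Lemma clamp_sum (n : nat) (t : R) : \sum_(k < n) clamp (t - k%:R) = Num.max 0 (Num.min n%:R t).
Proof.
elim: n => [|n ih]; first by rewrite big_ord0; apply/esym/max_idPl; rewrite ge_min lexx.
have n0 : (0 : R) <= n%:R by rewrite ler0n.
rewrite big_ord_recr/= ih -natr1; have [tn|nt] := leP t n%:R.
  by rewrite clamp_eq0 ?subr_le0// addr0 min_r// (le_trans tn)// lerDl.
rewrite (max_r n0); have [tn1|nt1] := leP t (n%:R + 1).
  by rewrite clamp_id ?subr_ge0 ?(ltW nt) ?lerBlDl// subrKC max_r// (le_trans n0)// ltW.
by rewrite clamp_eq1 ?lerBrDl ?(ltW nt1)// max_r// addr_ge0.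
Qed.

(* [n f] is the sum of the slices [clamp (n f - k)], and slice [k + 1] is at most the
   indicator of the set where slice [k] equals [1]. *)
Lemma riesz_le_Lam f n : bcont f -> (forall x, 0 <= f x <= 1) ->
  n%:R * \int[riesz]_x f x - 1 <= n%:R * Lam f.
Proof.
move=> bf f01; have [cf _] := bf.
have r1 : riesz setT = 1%E by exact: riesz_setT.
pose fn (t : R) (k : nat) x := clamp (n%:R * f x - t - k%:R).
have cnf : continuous (fun x => n%:R * f x).
  by move=> x; apply: cvgMl_tmp; exact: cf.
have bfn t k : bcont (fn t k).
  apply: bcont_clamp => x; apply: cvgB; last exact: cvg_cst.
  by apply: cvgB; [exact: cnf|exact: cvg_cst].
have bm g : bcont g -> @bmeas _ (borel X) R g by exact: bcont_bmeas.
have slice (k : nat) : \int[riesz]_x fn 1 k x <= Lam (fn 0 k).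
  pose A : set (borel X) := [set x | fn 0 k x = 1].
  have mA : measurable A.
    rewrite -[A]setTI; have [mf _] := bm _ (bfn 0 k).
    by apply: (mf measurableT [set 1]).
  apply: (@le_trans _ _ (\int[riesz]_x \1_A x)).
    apply: (bintegral_le r1) => [||x]; [exact: bm|exact: bmeas_indic|].
    have [wk|wk] := leP (k%:R + 1) (n%:R * f x).
      rewrite (_ : \1_A x = 1) ?clamp_le1//; rewrite indicE mem_set// /A /= /fn clamp_eq1//; lra.
    rewrite /fn clamp_eq0 ?indicE ?ler0n//; lra.
  rewrite -lee_fin (bintegral_indic r1)// lee_fin; apply: inf_cover_le.
  apply: cover_cost_fun; first exact: bfn.
    by move=> x; exact: clamp_ge0.
  by move=> x /= ->.
have sum_fn t x : \sum_(k < n) fn t k x = Num.max 0 (Num.min n%:R (n%:R * f x - t)).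
  exact: clamp_sum.
have nf0 x : 0 <= n%:R * f x by rewrite mulr_ge0 ?ler0n//; have /andP[] := f01 x.
have nfn x : n%:R * f x <= n%:R by rewrite ler_piMr ?ler0n//; have /andP[] := f01 x.
have int_sum (h : nat -> X -> R) j : (forall i, bcont (h i)) ->
    \int[riesz]_x (\sum_(i < j) h i x) = \sum_(i < j) \int[riesz]_x h i x.
  move=> bh; elim: j => [|j ih].
    by rewrite big_ord0; under eq_Rintegral do rewrite big_ord0; rewrite (bintegral_cst r1).
  rewrite big_ord_recr/= -ih -(bintegralD r1); [|exact/bm/bcont_sum|exact/bm/bh].
  by apply: eq_Rintegral => x _; rewrite big_ord_recr.
apply: (@le_trans _ _ (\int[riesz]_x (\sum_(k < n) fn 1 k x))).
  rewrite -(bintegralZ r1)//; last exact: bm.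
  rewrite -[X in _ - X](bintegral_cst r1) -(bintegralB r1); [|exact/bmeasZ/bm|exact: bmeas_cst].
  apply: (bintegral_le r1) => [||x].
  - by apply: bmeasB; [exact/bmeasZ/bm|exact: bmeas_cst].
  - by apply/bm/bcont_sum => k; exact: bfn.
  rewrite sum_fn le_max; apply/orP; right.
  by rewrite le_min lexx andbT; have := nfn x; lra.
rewrite (int_sum (fn 1) n (bfn 1)).
apply: (@le_trans _ _ (\sum_(k < n) Lam (fn 0 k))); first exact: ler_sum.
rewrite -(@Lam_sum (fn 0) n (bfn 0)) -LamZ//.
apply: Lam_le; [exact: (bcont_sum n (bfn 0))|exact: bcontZ|].
by move=> x; rewrite sum_fn subr0 ge_max nf0 ge_min lexx orbT.
Qed.

Lemma riesz_le_Lam_unit f : bcont f -> (forall x, 0 <= f x <= 1) ->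
  \int[riesz]_x f x <= Lam f.
Proof.
move=> bf f01; apply/ler_addgt0Pr => e e0.
pose n := (Num.truncn e^-1).+1.
have n0 : (0 : R) < n%:R by rewrite ltr0n.
have ne : 1 <= n%:R * e by rewrite -ler_pdivrMr// mul1r ltW// truncnS_gt.
by have := riesz_le_Lam n bf f01 => ?; rewrite -(ler_pM2l n0) mulrDr; lra.
Qed.

(** An affine change of [f] has values in [[0, 1]], where integral is at most [Lam]; the inequality
    for [- f] is the reverse one. *)
Lemma daniell : exists mu : probability (borel X) R,
  forall f, bcont f -> \int[mu]_x f x = Lam f.
Proof.
exists riesz.
have r1 : riesz setT = 1%E by exact: riesz_setT.
have bm g : bcont g -> @bmeas _ (borel X) R g by exact: bcont_bmeas.
have le f : bcont f -> \int[riesz]_x f x <= Lam f.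
  move=> bf; have [_ [M0 fM0]] := bf; pose M := `|M0| + 1.
  have M_gt0 : 0 < M by rewrite ltr_pwDr.
  have fM x : `|f x| <= M by rewrite (le_trans (fM0 x))// ler_wpDr// ler_norm.
  pose a := (2 * M)^-1; have a0 : 0 < a by rewrite invr_gt0 mulr_gt0.
  have baf : bcont (fun x => a * f x) by exact: bcontZ.
  have b2 := @bcont_cst R X 2^-1.
  have := @riesz_le_Lam_unit (fun x => a * f x + 2^-1).
  rewrite (bintegralD r1) ?LamD//; [|exact: bm|exact: bm].
  rewrite (bintegral_cst r1) Lam_cst (bintegralZ r1) ?LamZ//; last exact: bm.
  rewrite lerD2r ler_pM2l//; apply; first exact: bcontD.
  move=> x; have aM : a * M = 2^-1 by rewrite /a; field; rewrite gt_eqF.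
  have := fM x; rewrite ler_norml => /andP[fl fu].
  have : a * - M <= a * f x by rewrite ler_pM2l.
  have : a * f x <= a * M by rewrite ler_pM2l.
  rewrite mulrN aM; lra.
move=> f bf; apply/eqP; rewrite eq_le le//=.
have := le _ (bcontZ (-1) bf); rewrite (bintegralZ r1) ?LamZ//; last exact: bm.
by rewrite !mulN1r lerN2.
Qed.

End daniell.

(** * Convergence to the invariant measure *)

Section borel_measures.
Context {R : realType} {X : completeMetricType R}.
Local Open Scope ring_scope.

Lemma open_mball (x : X) (e : R) : open (ball x e).
Proof.
rewrite openE => y xy; apply/nbhs_ballP; exists (e - mdist x y).
  by rewrite /= subr_gt0; move: xy; rewrite ballEmdist.
move=> v; rewrite !ballEmdist/= => yv.
by rewrite (le_lt_trans (metric_triangle x y v))//; lra.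
Qed.

Lemma measurable_mball (x : X) (e : R) : measurable (ball x e : set (borel X)).
Proof. by apply: open_measurable_borel; exact: open_mball. Qed.

(** Each point off the support lies in a null ball with centre in a countable dense set and radius
    [k.+1%:R^-1]. These balls are indexed by the image [i] of the centre under an injection into the
    naturals. *)
Lemma ae_msupport (mu : {measure set (borel X) -> \bar R}) :
  separable X -> {ae mu, forall x, msupport mu x}.
Proof.
move=> [D /countable_injP[f finj] dD].
pose F i k := [set x : borel X | exists d, [/\ D d, f d = i,
  mu (ball d k.+1%:R^-1) = 0%E & ball d (k.+1%:R^-1 : R) x]].
have negF i k : mu.-negligible (F i k).
  have [[d [Dd fd mu0]]|nd] := pselect (exists d, [/\ D d, f d = i & mu (ball d k.+1%:R^-1) = 0%E]).
    exists (ball d k.+1%:R^-1); split => //; first exact: measurable_mball.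
    move=> x [d' [Dd' fd' _ d'x]].
    suff -> : d = d' by [].
    by apply: finj; [exact: mem_set|exact: mem_set|rewrite fd fd'].
  rewrite (_ : F i k = set0); first exact: negligible_set0.
  apply/seteqP; split => // x [d [Dd fd mu0 _]]; apply: nd; by exists d.
apply: negligibleS (negligible_bigcup (fun i => negligible_bigcup (negF i))) => x /= nsupp.
have [e e0 mue] : exists2 e : R, 0 < e & mu (ball x e) = 0%E.
  apply: contrapT => ne; apply: nsupp => e e0; rewrite lt0e measure_ge0 andbT.
  by apply/eqP => mu0; apply: ne; exists e.
have [k ke] : exists k : nat, k.+1%:R^-1 < e / 2.
  near \oo%classic => k; exists k; near: k.
  have e2 : 0 < e / 2 by rewrite divr_gt0.
  exact: (near_infty_natSinv_lt (PosNum e2)).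
have k0 : (0 : R) < k.+1%:R^-1 by rewrite invr_gt0 ltr0n.
have [d [xd Dd]] := dD (ball x k.+1%:R^-1) (ex_intro _ x (ballxx x k0)) (open_mball x _).
exists (f d) => //; exists k => //; exists d; split => //; last exact: ball_sym.
apply: (subset_measure0 (measurable_mball _ _) (measurable_mball x e) _ mue).
have ke2 : (k.+1%:R^-1 : R) + k.+1%:R^-1 <= e by move: ke; set q := k.+1%:R^-1; lra.
by move=> y dy; apply: le_ball ke2 _ (ball_triangle xd dy).
Unshelve. all: by end_near. Qed.

Lemma measure_eq_bcont (m1 m2 : {measure set (borel X) -> \bar R}) :
  m1 setT = 1%E -> m2 setT = 1%E ->
  (forall f, bcont f -> \int[m1]_x f x = \int[m2]_x f x) ->
  forall A : set (borel X), measurable A -> m1 A = m2 A.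
Proof.
move=> m1T m2T eq_int A mA; apply: (@measure_unique _ R (borel X) (@open X) (fun=> setT)) => //.
- by move=> B C oB oC; exact: openI.
- by move=> i; exact: openT.
- by rewrite bigcup_const.
- move=> U oU; have mU := open_measurable_borel oU.
  rewrite -(bintegral_indic m1T mU) -(bintegral_indic m2T mU); congr EFin.
  have cvg_inner (m : {measure set (borel X) -> \bar R}) : m setT = 1%E ->
      \int[m]_x inner U n x @[n --> \oo] --> \int[m]_x \1_U x.
    move=> mT; apply: (bintegral_cvg mT (M := 1)).
    - by move=> n; exact/bcont_bmeas/bcont_inner.
    - exact: bmeas_indic.
    - by move=> n x; rewrite ger0_norm ?clamp_ge0// clamp_le1.
    - apply: aeW => x; apply: cvg_near_cst; rewrite indicE.
      have [Ux|Ux] := pselect (U x).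
        have [N uN] := inner_eq1 oU Ux; exists N => // n /= Nn.
        by rewrite mem_set//; exact: uN.
      by apply: nearW => n; rewrite inner_eq0// memNset.
  have := cvg_inner _ m1T.
  rewrite (_ : (fun n => _) = fun n => \int[m2]_x inner U n x); last first.
    by apply/funext => n; apply: eq_int; exact: bcont_inner.
  by move/cvg_unique; apply => //; exact: cvg_inner.
- by move=> _; rewrite m1T ltry.
Qed.

End borel_measures.

Section asymptotic_stability.
Context {R : realType} {X : completeMetricType R}.
Variables (P : R.-pker (borel X) ~> (borel X)) (z : X).
Local Open Scope ring_scope.

(** The lower limit is the supremum of the tail infima, and a positive one serves as [a]. Tents
    replace open sets because equicontinuity is available for continuous functions; a tent dominates
    the indicator of the ball of half radius. *)
Lemma recurrent_of_liminf :
  (forall O : set X, open O -> O z ->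
    forall x : X, (0 < limn_einf (fun n => nstep P n x O))%E) ->
  forall (r : R) (x : X), 0 < r -> exists2 a : R, 0 < a &
    exists N, forall n, (N <= n)%N -> a <= nexp P n (tent z r) x.
Proof.
move=> liminf r x r0; have r2 : 0 < r / 2 by rewrite divr_gt0.
have := liminf _ (open_mball z (r / 2)) (ballxx z r2) x.
rewrite limn_einf_lim; set u := fun n => _.
rewrite (cvg_lim _ (@cvg_einfs_sup _ u))// => /ereal_sup_gt[_ [N _ <-] uN].
have u_le k : (N <= k)%N -> (einfs u N <= u k)%E.
  by move=> Nk; apply: ereal_inf_lbound; exists k.
have u_tent k : (u k <= (nexp P k (tent z r) x)%:E)%E.
  rewrite [leLHS](esym (nexp_indic P k x (measurable_mball z (r / 2)))) lee_fin; apply: nexp_le.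
  - by apply: bmeas_indic; exact: measurable_mball.
  - exact/bcont_bmeas/bcont_tent.
  - move=> y; rewrite indicE; have [/set_mem zy|_] := boolP (y \in _); last exact: tent_ge0.
    by rewrite tent_eq1.
have fin_einfs : einfs u N \is a fin_num.
  rewrite ge0_fin_numE ?(ltW uN)//.
  by apply: (le_lt_trans (le_trans (u_le N (leqnn N)) (u_tent N))); rewrite ltry.
exists (fine (einfs u N)); first by rewrite fine_gt0// uN/= ltey_eq fin_einfs.
exists N => n Nn; rewrite -lee_fin fineK//.
exact: le_trans (u_le n Nn) (u_tent n).
Qed.

Hypothesis equicP : forall f, bcont f -> equicont P f.
Hypothesis recurrent : forall (r : R) (x : X), 0 < r -> exists2 a : R, 0 < a &
  exists N, forall n, (N <= n)%N -> a <= nexp P n (tent z r) x.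

Lemma subfunctional_nexp i : subfunctional P z (fun h => nexp P i h z) 1.
Proof.
exists i; split.
- by move=> f g mf mg; exact: nexpDl.
- by move=> c f mf; exact: nexpZ.
- by move=> h mh h0; rewrite lexx andbT; exact: nexp_ge_cst.
- exact: nexp_cst.
Qed.

Definition lim_nexp f := limn (fun n => nexp P n f z).

(** A Cauchy sequence: for [n >= n0], [P^n f(z)] is [P^n0 f] integrated against the law at time
    [n - n0], and the coupling compares this law with the Dirac mass at [z]. *)
Lemma cvg_lim_nexp f : bcont f -> nexp P n f z @[n --> \oo] --> lim_nexp f.
Proof.
move=> bf; suff : cvgn (fun n => nexp P n f z) by [].
apply: cauchy_cvg; apply: cauchy_exP => e e0; have e2 : 0 < e / 2 by rewrite divr_gt0.
have [n0 n0P] := coupling equicP recurrent bf e2.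
exists (nexp P n0 f z); exists n0 => // n /= n0n.
have mf := bcont_bmeas bf.
rewrite /ball/= distrC.
have := n0P _ _ _ (subfunctional_nexp (n - n0)) (subfunctional_nexp 0) n0 (leqnn _).
rewrite -nexpD// subnK// -[nexp P 0 _]nexpD// add0n => /le_lt_trans; apply; lra.
Qed.

Lemma lim_nexp_measure : exists mu : probability (borel X) R,
  forall f, bcont f -> \int[mu]_x f x = lim_nexp f.
Proof.
have bm g : bcont g -> @bmeas _ (borel X) R g by exact: bcont_bmeas.
apply: daniell.
- move=> f g bf bg; apply: cvg_lim => //.
  rewrite (_ : (fun n => _) = fun n => nexp P n f z + nexp P n g z).
    by apply: cvgD; exact: cvg_lim_nexp.
  by apply/funext => n; rewrite nexpDl//; exact: bm.
- move=> c f bf; apply: cvg_lim => //.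
  rewrite (_ : (fun n => _) = fun n => c * nexp P n f z).
    by apply: cvgMl_tmp; exact: cvg_lim_nexp.
  by apply/funext => n; rewrite nexpZ//; exact: bm.
- move=> f bf f0; apply: limr_ge; first exact: cvgP (cvg_lim_nexp bf).
  by apply: nearW => n; apply: nexp_ge_cst => //; exact: bm.
- apply: cvg_lim => //; apply: cvg_near_cst; apply: nearW => n.
  by rewrite nexp_cst.
move=> h bh h01 nd_h h1 e e0.
have e2 : 0 < e / 2 by rewrite divr_gt0.
(* Where [h Q <= 1 - e / 2], [g Q] vanishes and so [l = 1]; hence [h Q >= (1 - e / 2) - l]
   everywhere, and [l] costs at most [e / 2] at all times. *)
pose g n x := clamp (h n x - (1 - e / 2)).
have bg n : bcont (g n).
  have [ch _] := bh n; apply: bcont_clamp => x; apply: cvgB; [exact: ch|exact: cvg_cst].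
have g_gt0 x : exists n, 0 < g n x.
  have [n hn] := h1 x; exists n; rewrite /g hn opprB addrC subrK.
  by rewrite /clamp lt_max lt_min ltr01 e2 orbT.
have g01 n x : 0 <= g n x <= 1 by rewrite clamp_ge0 clamp_le1.
have nd_g n m x : (n <= m)%N -> g n x <= g m x.
  by move=> nm; apply: clamp_le; rewrite lerB// nd_h.
have [Q [c [l [c0 bl l01 lP lk]]]] :=
  dini equicP recurrent (fun n => (bg n).1) g01 nd_g g_gt0 e2.
exists Q; apply: limr_ge; first exact: cvgP (cvg_lim_nexp (bh Q)).
apply: nearW => n; apply: (@le_trans _ _ (nexp P n (fun x => (1 - e / 2) - l x) z)).
  rewrite nexpB; [|exact: bmeas_cst|exact: bm].
  by rewrite nexp_cst; have := lk n; lra.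
apply: nexp_le; [by apply: bmeasB; [exact: bmeas_cst|exact: bm]|exact: (bm _ (bh Q))|move=> x].
have [he|he] := leP (h Q x) (1 - e / 2).
  rewrite lP; first by have /andP[] := h01 Q x; lra.
  by rewrite /g clamp_eq0 ?(ltW c0)// subr_le0.
by have /andP[] := l01 x; lra.
Qed.

Lemma nexp_indic_subfunctional m (A : set (borel X)) : measurable A ->
  subfunctional P z (fun h => nexp P m (fun x => \1_A x * h x) z) (nexp P m \1_A z).
Proof.
move=> mA; have bA : bmeas (\1_A : borel X -> R) by exact: bmeas_indic.
have A01 (x : borel X) : 0 <= (\1_A x : R) <= 1.
  by rewrite indicE; case: (_ \in _); rewrite lexx ler01.
exists m; split.
- move=> f g mf mg; rewrite -nexpDl; [|exact: bmeasM|exact: bmeasM].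
  by congr nexp; apply/funext => x; rewrite mulrDr.
- move=> c f mf; rewrite -nexpZ; last exact: bmeasM.
  by congr nexp; apply/funext => x; rewrite mulrCA.
- move=> h mh h0; have mAh := bmeasM bA mh; apply/andP; split.
    by apply: nexp_ge_cst => // x; rewrite mulr_ge0//; have /andP[] := A01 x.
  by apply: nexp_le => // x; rewrite ler_piMl//; have /andP[] := A01 x.
- by congr nexp; apply/funext => x; rewrite mulr1.
Qed.

(** The law at time [m] gives mass [t > 0] to a ball on which every [P^n f] is within [e / 2] of its
    value at [x]. The coupling of this piece with [t] times the Dirac mass at [z] is pushed to
    precision [t * (e / 2)], and [t] is divided out. *)
Lemma nexp_cvg_msupport m x f e : msupport (nstep P m z) x -> bcont f -> 0 < e ->
  exists n0, forall n, (n0 <= n)%N -> `|nexp P n f x - nexp P n f z| <= e.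
Proof.
move=> sx bf e0; have mf := bcont_bmeas bf.
have e2 : 0 < e / 2 by rewrite divr_gt0.
have [d d0 fd] := equicP bf x e2.
pose A : set (borel X) := ball x d.
have mA : measurable A by exact: measurable_mball.
have bA : bmeas (\1_A : borel X -> R) by exact: bmeas_indic.
set t := nexp P m \1_A z.
have t0 : 0 < t by rewrite -lte_fin nexp_indic//; exact: sx.
have LA := nexp_indic_subfunctional m mA.
have Lz : subfunctional P z (fun h => t * nexp P 0 h z) t.
  have /andP[_ t1] := subfunctional_mass LA; exists 0%N; split.
  - by move=> f' g' mf' mg'; rewrite nexpDl// mulrDr.
  - by move=> c f' mf'; rewrite nexpZ// mulrCA.
  - move=> h mh h0; have h0z : 0 <= nexp P 0 h z by exact: nexp_ge_cst.
    by rewrite mulr_ge0 ?(ltW t0)//= ler_piMl.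
  - by rewrite nexp_cst mulr1.
have te : 0 < t * (e / 2) by rewrite mulr_gt0.
have [n0 n0P] := coupling equicP recurrent bf te.
exists n0 => n n0n; have mnf := bmeas_nexp P n mf.
have := n0P _ _ _ LA Lz n n0n; rewrite -nexpD// add0n.
set I := nexp P m _ z => Iz.
have Ix : `|I - t * nexp P n f x| <= t * (e / 2).
  have mAn := bmeasM bA mnf; have mAx := bmeasZ (nexp P n f x) bA.
  have -> : I - t * nexp P n f x =
      nexp P m (fun y => \1_A y * nexp P n f y - nexp P n f x * \1_A y) z.
    by rewrite nexpB// nexpZ// mulrC.
  have meA := bmeasZ (e / 2) bA.
  have mdiff := bmeasB mAn mAx.
  have pt (y : borel X) : `|\1_A y * nexp P n f y - nexp P n f x * \1_A y| <= e / 2 * \1_A y.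
    rewrite mulrC -mulrBl normrM indicE; have [/set_mem Ay|_] := boolP (y \in A).
      by rewrite normr1 !mulr1; exact: fd.
    by rewrite normr0 !mulr0.
  rewrite mulrC -nexpZ// ler_norml; apply/andP; split.
    rewrite -mulN1r -nexpZ//; apply: nexp_le => //; first exact: bmeasZ.
    by move=> y; rewrite mulN1r; have := pt y; rewrite ler_norml => /andP[].
  by apply: nexp_le => // y; have := pt y; rewrite ler_norml => /andP[].
have : t * `|nexp P n f x - nexp P n f z| <= t * e.
  rewrite -{1}(ger0_norm (ltW t0)) -normrM mulrBr.
  rewrite (_ : _ - _ = (I - t * nexp P n f z) - (I - t * nexp P n f x)); last by ring.
  rewrite (le_trans (ler_normB _ _))//; lra.
by rewrite ler_pM2l.
Qed.

Lemma nexp_cvg_closure_msupport x f :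
  closure (\bigcup_(n in [set n | (0 < n)%N]) msupport (nstep P n z)) x -> bcont f ->
  nexp P n f x @[n --> \oo] --> lim_nexp f.
Proof.
move=> Zx bf; apply/cvgrPdist_le => e e0.
have e3 : 0 < e / 3 by rewrite divr_gt0.
have [d d0 fd] := equicP bf x e3.
have [y [[m _ sy] xy]] := Zx (ball x d) (nbhsx_ballx x d d0).
have [n0 n0P] := nexp_cvg_msupport sy bf e3.
have /cvgrPdist_le/(_ _ e3)[n1 _ n1P] := cvg_lim_nexp bf.
exists (maxn n0 n1) => // n /=; rewrite geq_max => /andP[n0n n1n].
have := fd y xy n; have := n0P n n0n; have := n1P n n1n.
rewrite !ler_norml => /andP[? ?] /andP[? ?] /andP[? ?]; apply/andP; split; lra.
Qed.

End asymptotic_stability.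

Theorem theorem3p1 (R : realType) (X : completeMetricType R)
    (P : R.-pker (borel X) ~> (borel X)) (z : X) :
  separable X ->
  feller P ->
  e_chain P ->
  (forall O : set X, open O -> O z ->
    forall x : X, 0 < limn_einf (fun n => nstep P n x O)) ->
  let Z := closure (\bigcup_(n in [set n | (0 < n)%N]) msupport (nstep P n z)) in
  (exists (V : X -> R) (lambda b r : R) (x0 : X),
    [/\ lyapunov V, (lambda < 1)%R &
        forall x : X, \int[P x]_y (V y)%:E <=
          (lambda * V x + b * \1_(ball x0 r) x)%:E]) ->
  exists mu_star : probability (borel X) R,
    [/\ invariant_measure mu_star P,
        msupport mu_star `<=` Z,
        (forall nu : probability (borel X) R,
          invariant_measure nu P -> msupport nu `<=` Z ->
          forall A : set (borel X), measurable A -> nu A = mu_star A) &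
        forall mu : probability (borel X) R, msupport mu `<=` Z ->
          cvg_weak (fun n => mapply mu (nstep P n)) mu_star].
Proof.
move=> sepX _ eP liminf Z [V [lambda [b [r [x0 [lyapV lambda1 PV]]]]]].
have equicP f : bcont f -> equicont P f.
  have tail := lyapunov_tail lyapV lambda1 PV; exact: (equicont_bcont tail eP).
have rec := recurrent_of_liminf liminf.
have bm f : bcont f -> @bmeas _ (borel X) R f by exact: bcont_bmeas.
have cvgZ x f : Z x -> bcont f -> (nexp P n f x @[n --> \oo] --> lim_nexp P z f)%R.
  exact: nexp_cvg_closure_msupport.
have [mu_star muE] := lim_nexp_measure equicP rec.
have prob1 (mu : probability (borel X) R) : mu setT = 1 by exact: probability_setT.
have mapply1 (mu : probability (borel X) R) n : mapply mu (nstep P n) setT = 1.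
  rewrite /= /mapply; under eq_integral do rewrite nstep_setT.
  by rewrite integral_cst// mul1e; exact: probability_setT.
have bcont_nexp n f : bcont f -> bcont (nexp P n f).
  move=> bf; split; last by case: (bmeas_nexp P n (bm _ bf)).
  apply/continuous_epsP => x e e0; have [d d0 dP] := equicP f bf x e e0.
  by exists d => // y xy; exact: dP.
have weak_cvg (mu : probability (borel X) R) f : msupport mu `<=` Z -> bcont f ->
    (\int[mu]_x nexp P n f x @[n --> \oo] --> lim_nexp P z f)%R.
  move=> muZ bf; have [_ [M fM]] := bf.
  rewrite -[X in _ --> X](bintegral_cst (prob1 mu)).
  apply: (bintegral_cvg (prob1 mu) (M := M)).
  - by move=> n; exact/bmeas_nexp/bm.
  - exact: bmeas_cst.
  - by move=> n x; apply: nexp_norm_le => //; exact: bm.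
  - apply: (@filterS _ _ (ae_filter_ringOfSetsType mu) _ _ _ (ae_msupport mu sepX)) => x.
    by move=> /muZ Zx; exact: cvgZ.
exists mu_star; split.
- apply: measure_eq_bcont.
  + exact: (mapply1 mu_star 1%N).
  + exact: prob1.
  (* The integral of [P f] is the limit of [P^(n + 1) f(z)], a shift of the sequence that defines
     the integral of [f]. *)
  + move=> f bf; rewrite (bintegral_mapply P mu_star 1 (bm _ bf)) muE; last exact: bcont_nexp.
    rewrite muE//; apply: cvg_lim => //.
    rewrite (_ : (fun n => _) = (fun n => nexp P (n + 1)%N f z)).
      by rewrite (cvg_shiftn 1 (fun n => nexp P n f z)); exact: cvg_lim_nexp.
    by apply/funext => n; rewrite nexpD//; exact: bm.
- move=> x sx; apply: contrapT => nZx.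
  have [d d0 dZ] : exists2 d : R, (0 < d)%R & forall y, ball x d y -> ~ Z y.
    apply: contrapT => nd; apply: nZx; apply: closed_closure.
    move=> B /nbhs_ballP[d /= d0 dB]; apply: contrapT => nB; apply: nd; exists d => // y xy Zy.
    by apply: nB; exists y; split => //; exact: dB.
  (* The tent vanishes on [Z], hence almost everywhere for each [P^n(z, .)] with [n >= 1], the times
     entering in [Z]; its limit 0 makes a ball around [x] null. *)
  have tent0 : lim_nexp P z (tent x d) = 0%R.
    apply: cvg_lim => //; apply: cvg_near_cst; exists 1%N => // n /= n0.
    rewrite -[RHS](nexp_cst P n 0 z); congr fine; apply: ae_eq_integral => //.
    + by apply/measurable_EFinP; case: (bm _ (bcont_tent x d)).
    + apply: (@filterS _ _ (ae_filter_ringOfSetsType _) _ _ _ (ae_msupport _ sepX)) => y sy _.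
      rewrite /= tent_eq0// => /dZ; apply; apply: subset_closure.
      by exists n.
  have d2 : (0 < d / 2)%R by rewrite divr_gt0.
  have := sx _ d2; apply/negP; rewrite -leNgt.
  have mB := measurable_mball x (d / 2).
  rewrite -(bintegral_indic (prob1 mu_star) mB) lee_fin -tent0 -muE; last exact: bcont_tent.
  apply: (bintegral_le (prob1 mu_star)); [exact: bmeas_indic|exact/bm/bcont_tent|move=> y].
  rewrite indicE; have [/set_mem zy|_] := boolP (y \in _); last exact: tent_ge0.
  by rewrite tent_eq1.
- move=> nu inv_nu nuZ; apply: measure_eq_bcont; [exact: prob1|exact: prob1|move=> f bf].
  (* For an invariant [nu] the integrals of [P^n f] are constant in [n], while they converge to the
     integral of [f] against [mu_star]. *)
  have inv_n n : (\int[nu]_x nexp P n f x = \int[nu]_x f x)%R.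
    elim: n => [|n ih]; first by rewrite nexp0//; exact: bm.
    rewrite nexpS; last exact: bm.
    rewrite -(bintegral_mapply P nu 1); last by apply: bmeas_nexp; exact: bm.
    by rewrite -ih; congr fine; apply: eq_measure_integral => A mA _; exact: inv_nu.
  rewrite muE//; have := weak_cvg nu f nuZ bf.
  under eq_fun do rewrite inv_n.
  by move/cvg_lim => <- //; rewrite lim_cst.
- move=> mu muZ f cf [M [_ fM]].
  have bf : bcont f.
    split => //; exists (`|M| + 1)%R => x; apply: fM => //.
    by rewrite ltr_pwDr// ler_norm.
  rewrite muE//; under eq_fun do rewrite (bintegral_mapply P mu _ (bm _ bf)).
  exact: weak_cvg.
Qed.
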